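(* Let $X$ be a connected multiplicity graph on the vertex set $[m]$ with multiplicities $c=(c_1,\dots,c_m)\in\mathbb{Z}_{>0}^m$ and total multiplicity $n=\sum_v c_v$, and let $\mathsf{Star}_n$ be the star on $n$ vertices. If $X$ is Wilsonian, then $\mathsf{FS}_m(\mathsf{Star}_n,X)$ is connected. If $X$ is biconnected but not Wilsonian, then $\mathsf{FS}_m(\mathsf{Star}_n,X)$ is connected if and only if there is a vertex $v\in V(X)$ with $c_v\geq 2$. If $X$ is not biconnected, then $\mathsf{FS}_m(\mathsf{Star}_n,X)$ is connected if and only if $c_v\geq 2$ for every cut vertex $v$ of $X$.
   Context: A multiplicity graph is a simple graph $Y$ on $m$ vertices together with a list $c\in\mathbb{Z}_{>0}^m$ of multiplicities; its total multiplicity is $\sum_{y}c_y$. For a simple graph $Z$ on $n$ vertices and a multiplicity graph $Y$ of total multiplicity $n$, $\mathsf{FS}_m(Z,Y)$ is the graph whose vertices are the functions $\sigma:V(Z)\to V(Y)$ with $|\sigma^{-1}(y)|=c_y$ for all $y$, where $\sigma,\tau$ are adjacent if $\sigma=\tau\circ(a\ b)$ for some $ab\in E(Z)$ with $\sigma(a)\sigma(b)\in E(Y)$. A graph is biconnected if it is connected and has no cut vertex (a vertex whose removal disconnects the graph). A graph is Wilsonian if it is biconnected, not bipartite, not a cycle of length at least $4$, and not isomorphic to $\theta_0$, where $\theta_0$ is the 7-vertex graph consisting of a 6-cycle $v_0v_1v_2v_3v_4v_5$ together with a vertex $v_6$ adjacent exactly to $v_0$ and $v_3$.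
   Formalization: In the second assertion the cases of X with at most two vertices and all multiplicities 1 (K_1 with c=(1), K_2 with c=(1,1)) are excluded, since there X is biconnected and not Wilsonian, no c_v≥2, yet FS_m(Star_n,X) is connected. *)

(* Defs.v *)
From mathcomp Require Import all_boot all_fingroup.

Set Implicit Arguments.
Unset Strict Implicit.
Unset Printing Implicit Defensive.

Record sgraph (T : finType) := SGraph {
  adj :> rel T;
  adj_sym : symmetric adj;
  adj_irrefl : irreflexive adj }.

Section SymGraph.
Variables (T : finType) (r : rel T).

Definition sym_rel : rel T := fun x y => (x != y) && (r x y || r y x).

Fact sym_rel_sym : symmetric sym_rel.
Proof. by move=> x y; rewrite /sym_rel eq_sym orbC. Qed.

Fact sym_rel_irrefl : irreflexive sym_rel.
Proof. by move=> x; rewrite /sym_rel eqxx. Qed.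

Definition sym_graph : sgraph T := SGraph sym_rel_sym sym_rel_irrefl.

End SymGraph.

(* The centre is the vertex 0. *)
Definition star (n : nat) : sgraph 'I_n :=
  sym_graph (fun i _ : 'I_n => val i == 0).

(* This is the cycle of length k only for 3 <= k. *)
Definition cycle_graph (k : nat) : sgraph 'I_k :=
  sym_graph (fun i j : 'I_k => val j == i.+1 %% k).

Definition theta0 : sgraph 'I_7 :=
  sym_graph (fun i j : 'I_7 => (val i, val j) \in
    [:: (0, 1); (1, 2); (2, 3); (3, 4); (4, 5); (5, 0); (6, 0); (6, 3)]).

Definition graph_iso (T U : finType) (G : sgraph T) (H : sgraph U) : Prop :=
  exists2 f : T -> U, bijective f & forall x y, adj H (f x) (f y) = adj G x y.

Section Connectivity.
Variables (T : finType) (G : sgraph T).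

Definition all_joined : Prop := forall x y : T, connect G x y.

Definition connected : Prop := 0 < #|T| /\ all_joined.

Definition bipartite : Prop :=
  exists f : T -> bool, forall x y, adj G x y -> f x != f y.

Variable v : T.

Fact del_vertex_sym :
  symmetric (fun x y : {x : T | x != v} => adj G (val x) (val y)).
Proof. by move=> x y; rewrite adj_sym. Qed.

Fact del_vertex_irrefl :
  irreflexive (fun x y : {x : T | x != v} => adj G (val x) (val y)).
Proof. by move=> x; rewrite adj_irrefl. Qed.

Definition del_vertex : sgraph {x : T | x != v} :=
  SGraph del_vertex_sym del_vertex_irrefl.

End Connectivity.

(* Meant for connected G.  Deleting the only vertex of a one-vertex graph
   leaves the empty graph, which does not count as disconnecting. *)
Definition cut_vertex (T : finType) (G : sgraph T) (v : T) : Prop :=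
  ~ all_joined (del_vertex G v).

Definition biconnected (T : finType) (G : sgraph T) : Prop :=
  connected G /\ forall v, ~ cut_vertex G v.

Definition wilsonian (T : finType) (G : sgraph T) : Prop :=
  [/\ biconnected G,
      ~ bipartite G,
      ~ (exists2 k, 4 <= k & graph_iso G (cycle_graph k)) &
      ~ graph_iso G theta0].

Record mgraph (T : finType) := MGraph {
  mgraph_graph :> sgraph T;
  mult : T -> nat;
  mult_gt0 : forall v, 0 < mult v }.

Definition total_mult (T : finType) (Y : mgraph T) : nat := \sum_v mult Y v.

Section FriendsAndStrangers.
Variables (V W : finType) (Z : sgraph V) (Y : mgraph W).

Definition fs_vertex : finType :=
  {s : {ffun V -> W} | [forall y, #|[set x | s x == y]| == mult Y y]}.

Definition fs_adj : rel fs_vertex := fun s t =>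
  [exists a, exists b,
    [&& adj Z a b, adj Y (val s a) (val s b) &
        val s == [ffun x => val t (tperm a b x)]]].

Fact fs_adj_sym : symmetric fs_adj.
Proof.
suff H s t : fs_adj s t -> fs_adj t s by move=> s t; apply/idP/idP; apply: H.
case/existsP=> a /existsP[b /and3P[Zab Yab /eqP st]].
apply/existsP; exists a; apply/existsP; exists b; apply/and3P; split=> //.
  by move: Yab; rewrite st !ffunE tpermL tpermR adj_sym.
by apply/eqP/ffunP=> x; rewrite st !ffunE tpermK.
Qed.

Fact fs_adj_irrefl : irreflexive fs_adj.
Proof.
move=> s; apply/existsP=> -[a /existsP[b /and3P[_ Yab /eqP/ffunP/(_ a)]]].
by rewrite ffunE tpermL => sab; rewrite sab adj_irrefl in Yab.
Qed.

Definition FS : sgraph fs_vertex := SGraph fs_adj_sym fs_adj_irrefl.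

End FriendsAndStrangers.

(* Main.v *)
Require Import Defs.
From mathcomp Require Import all_boot all_fingroup.
From mathcomp Require Import zify.

(** A state is a placement of tokens on the vertices of [X]; the centre of the
    star is a hole, and the moves are those of a sliding puzzle.  Blowing up
    every vertex of [X] into a clique of [mult X v] places gives a simple graph
    whose moves project to moves of [X] or to nothing, and this graph is
    biconnected as soon as every cut vertex of [X] has multiplicity at least
    two; it contains a triangle unless all multiplicities are one.  All positive
    statements therefore follow from Wilson's theorem on the sliding puzzle of a
    simple graph.

    To prove Wilson's theorem, call two tokens related when some closed walk of
    the hole realises a 3-cycle moving both of them.  This is an equivalence
    relation, transported by walks of the hole.  If all tokens of a subgraph are
    related, the same holds after adding an ear, so it suffices to treat one
    theta subgraph.  With the hole at a branch vertex, the commutator of two of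
    its cycles is a 3-cycle (if one of the three paths is an edge) or a product
    of two disjoint transpositions, and two conjugates of such products combine
    into a 3-cycle unless the paths have 1, 2 and 2 inner vertices, which is
    [theta0]; a biconnected graph properly containing [theta0] contains another
    theta graph.  An odd cycle then supplies an odd permutation.

    In the remaining cases an invariant separates states: parity for bipartite
    graphs, the cyclic order for cycles, a partition of the pairs of tokens into
    five perfect matchings for [theta0], and the set of tokens behind a cut
    vertex of multiplicity one. *)

Set Implicit Arguments.
Unset Strict Implicit.
Unset Printing Implicit Defensive.

(** * Three-cycles and walks of the hole *)

Section ThreeCycles.
Variable T : finType.
Implicit Types (x y z t r : T) (s : {perm T}).
Local Open Scope group_scope.

(** Products act from left to right, so distinct points move as [x] to [y] to [z] to [x]; for
    [y = z] the product is the identity. *)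
Definition cycle3 x y z : {perm T} := tperm x y * tperm x z.

Lemma cycle3V x y z : (cycle3 x y z)^-1 = cycle3 x z y.
Proof. by rewrite /cycle3 invMg !tpermV. Qed.

Lemma cycle3J x y z s : cycle3 x y z ^ s = cycle3 (s x) (s y) (s z).
Proof. by rewrite /cycle3 conjMg !tpermJ. Qed.

Lemma cycle3_1 x y z : x != y -> y != z -> cycle3 x y z x = y.
Proof. by move=> xy yz; rewrite permM tpermL tpermD // eq_sym. Qed.

Lemma cycle3_2 x y z : cycle3 x y z y = z.
Proof. by rewrite permM tpermR tpermL. Qed.

Lemma cycle3_3 x y z : x != z -> y != z -> cycle3 x y z z = x.
Proof. by move=> xz yz; rewrite permM (tpermD xz yz) tpermR. Qed.

Lemma cycle3D x y z t : x != t -> y != t -> z != t -> cycle3 x y z t = t.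
Proof. by move=> xt yt zt; rewrite permM !tpermD. Qed.

Lemma uniq3 x y z : uniq [:: x; y; z] = [&& x != y, x != z & y != z].
Proof. by rewrite /= !inE negb_or andbT andbA. Qed.

Lemma cycle3_rot x y z : uniq [:: x; y; z] -> cycle3 x y z = cycle3 y z x.
Proof.
rewrite uniq3 => /and3P[xy xz yz]; apply/permP => t.
have [->|tx] := eqVneq t x; first by rewrite cycle3_1 // cycle3_3 // eq_sym.
have [->|ty] := eqVneq t y; first by rewrite cycle3_2 cycle3_1 // eq_sym.
have [->|tz] := eqVneq t z; first by rewrite cycle3_3 // cycle3_2.
by rewrite !cycle3D // eq_sym.
Qed.

Lemma cycle3_sqr x y z : uniq [:: x; y; z] ->
  cycle3 x y z * cycle3 x y z = cycle3 x z y.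
Proof.
rewrite uniq3 => /and3P[xy xz yz]; apply/permP => t; rewrite permM.
have [->|tx] := eqVneq t x.
  by rewrite cycle3_1 // cycle3_2 cycle3_1 // eq_sym.
have [->|ty] := eqVneq t y.
  by rewrite cycle3_2 !cycle3_3 // eq_sym.
have [->|tz] := eqVneq t z.
  by rewrite cycle3_3 // cycle3_1 // cycle3_2.
by rewrite !cycle3D // eq_sym.
Qed.

End ThreeCycles.

Section HoleWalks.
Variables (T : finType) (G : sgraph T).
Implicit Types (u v w x y z t r : T) (s : {perm T}) (p : seq T).
Local Open Scope group_scope.

(* A state is the position of the hole with the permutation of the places
   performed so far; moving the hole from [u] to [v] swaps the contents of
   these two places. *)
Definition move_rel : rel (T * {perm T}) := fun a b =>
  adj G a.1 b.1 && (b.2 == a.2 * tperm a.1 b.1).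

Definition hole_walk u v s : bool := connect move_rel (u, 1) (v, s).

Lemma move_rel_sym : symmetric move_rel.
Proof.
suff H a b : move_rel a b -> move_rel b a by move=> a b; apply/idP/idP; apply: H.
case/andP=> ab /eqP eb; rewrite /move_rel adj_sym ab eb /=.
by rewrite [tperm b.1 _]tpermC -mulgA tperm2 mulg1.
Qed.

(** Moves multiply on the right, so left translation is a symmetry of the graph of states. This lets
    walks of the hole be composed and inverted. *)
Lemma connect_move_mull u v s (t r : {perm T}) :
  connect move_rel (u, s) (v, t) -> connect move_rel (u, r * s) (v, r * t).
Proof.
case/connectP=> p; elim: p u s => [|[u' s'] p IHp] u s /=.
  by move=> _ [-> ->].
case/andP=> /andP[/= uu' /eqP ss'] up pe.
apply: connect_trans (IHp _ _ up pe); apply: connect1.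
by rewrite /move_rel /= uu' ss' mulgA eqxx.
Qed.

Lemma hole_walk1 u : hole_walk u u 1.
Proof. exact: connect0. Qed.

Lemma hole_walkM u v w s (t : {perm T}) :
  hole_walk u v s -> hole_walk v w t -> hole_walk u w (s * t).
Proof.
move=> us vt; apply: connect_trans us _.
by rewrite -{1}(mulg1 s); apply: connect_move_mull.
Qed.

Lemma hole_walkV u v s : hole_walk u v s -> hole_walk v u s^-1.
Proof.
rewrite /hole_walk (sym_connect_sym move_rel_sym) => us.
by move/(connect_move_mull s^-1): us; rewrite mulVg mulg1.
Qed.

Lemma hole_walk_adj u v : adj G u v -> hole_walk u v (tperm u v).
Proof. by move=> uv; apply: connect1; rewrite /move_rel /= uv mul1g eqxx. Qed.

Lemma hole_walk_conj u v s (t : {perm T}) :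
  hole_walk u v s -> hole_walk u u t -> hole_walk v v (t ^ s).
Proof.
by move=> us ut; rewrite /conjg; apply: hole_walkM (hole_walkV us) (hole_walkM ut us).
Qed.

Lemma hole_walkX u s n : hole_walk u u s -> hole_walk u u (s ^+ n).
Proof.
move=> us; elim: n => [|n IHn]; first exact: hole_walk1.
by rewrite expgS; apply: hole_walkM us IHn.
Qed.

Lemma hole_walk_end u v s : hole_walk u v s -> s u = v.
Proof.
have H (p : seq (T * {perm T})) w (t : {perm T}) : path move_rel (w, t) p -> t u = w ->
    (last (w, t) p).2 u = (last (w, t) p).1.
  elim: p w t => [//|[w' t'] p IHp] w t /=.
  case/andP=> /andP[/= _ /eqP ->] wp tu; apply: IHp => //.
  by rewrite permM tu tpermL.
case/connectP=> p up e; have := H _ _ _ up (perm1 u).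
by rewrite -e.
Qed.

(** A closed walk fixes the place of the hole, so the 3-cycle never moves [v]. The case [x == y]
    gives reflexivity even where no 3-cycle is available. *)
Definition related v x y : bool :=
  (x == y) || [exists z, uniq [:: x; y; z] && hole_walk v v (cycle3 x y z)].

Lemma relatedxx v x : related v x x.
Proof. by rewrite /related eqxx. Qed.

Lemma cycle3_related v x y z :
  uniq [:: x; y; z] -> hole_walk v v (cycle3 x y z) -> related v x y.
Proof. by move=> U W; apply/orP; right; apply/existsP; exists z; rewrite U. Qed.

Lemma related_sym v x y : related v x y -> related v y x.
Proof.
case/orP=> [/eqP->|/existsP[z /andP[U W]]]; first exact: relatedxx.
have := hole_walkV W; rewrite (cycle3_rot U) cycle3V.
by apply: cycle3_related; move: U; rewrite !uniq3 eq_sym => /and3P[-> -> ->].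
Qed.

(* All cases are obtained by conjugating one 3-cycle by the other. *)
Lemma related_cycle3 v x y t : uniq [:: x; y; t] ->
  related v x y -> related v y t -> hole_walk v v (cycle3 x y t).
Proof.
move=> Ut; move: (Ut); rewrite uniq3 => /and3P[xy xt yt].
case/orP=> [/eqP e|/existsP[z /andP[Uz Wz]]]; first by rewrite e eqxx in xy.
case/orP=> [/eqP e|/existsP[r /andP[Ur Wr]]]; first by rewrite e eqxx in yt.
move: (Uz); rewrite uniq3 => /and3P[_ xz yz].
move: (Ur); rewrite uniq3 => /and3P[_ yr tr].
have [<- //|zt] := eqVneq z t.
have [rx|rx] := eqVneq r x.
  by rewrite cycle3_rot // -rx.
have [zr|zr] := eqVneq z r.
  subst r; have := hole_walk_conj Wr Wz; rewrite cycle3J.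
  rewrite cycle3D 1?eq_sym // cycle3_1 // cycle3_3 //.
  by move/hole_walkV; rewrite cycle3V.
have Wc : hole_walk v v (cycle3 x t z).
  have := hole_walk_conj Wr Wz; rewrite cycle3J.
  have -> : cycle3 y t r x = x by rewrite cycle3D // eq_sym.
  by rewrite cycle3_1 // cycle3D // eq_sym.
have := hole_walk_conj Wc Wz; rewrite cycle3J.
have -> : cycle3 x t z x = t by rewrite cycle3_1 // eq_sym.
have -> : cycle3 x t z y = y by rewrite cycle3D // eq_sym.
have -> : cycle3 x t z z = x by rewrite cycle3_3 // eq_sym.
rewrite -cycle3V => /hole_walkV; rewrite invgK cycle3_rot //.
by rewrite uniq3 ![t == _]eq_sym xt yt xy.
Qed.

Lemma related_trans v x y t : related v x y -> related v y t -> related v x t.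
Proof.
have [->//|xy] := eqVneq x y; have [->//|yt] := eqVneq y t.
have [-> _ _|xt] := eqVneq x t; first exact: relatedxx.
have U : uniq [:: x; y; t] by rewrite uniq3 xy xt.
move=> Rx Ry; have := hole_walkV (related_cycle3 U Rx Ry).
by rewrite cycle3V; apply: cycle3_related; rewrite uniq3 xt xy eq_sym.
Qed.

Lemma related_walk u v s x y :
  hole_walk u v s -> related u x y -> related v (s x) (s y).
Proof.
move=> us /orP[/eqP->|/existsP[z /andP[U W]]]; first exact: relatedxx.
have := hole_walk_conj us W; rewrite cycle3J; apply: cycle3_related.
by move: U; rewrite !uniq3 !(inj_eq perm_inj).
Qed.

Fixpoint path_perm u p : {perm T} :=
  if p is x :: p' then tperm u x * path_perm x p' else 1.

Lemma path_perm_walk u p : path G u p -> hole_walk u (last u p) (path_perm u p).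
Proof.
elim: p u => [|x p IHp] u /=; first by move=> _; apply: hole_walk1.
case/andP=> ux xp; apply: hole_walkM (IHp _ xp); exact: hole_walk_adj.
Qed.

Lemma path_perm_out u p x : x \notin u :: p -> path_perm u p x = x.
Proof.
elim: p u => [|y p IHp] u; first by rewrite perm1.
rewrite /= inE negb_or => /andP[xu xyp]; rewrite permM.
move: (xyp); rewrite inE negb_or => /andP[xy _].
by rewrite tpermD 1?eq_sym // IHp.
Qed.

(** A hole running along a simple path pulls each token on it one place back, towards the start of
    the path. *)
Lemma path_perm_in u p1 y p2 : uniq (u :: p1 ++ y :: p2) ->
  path_perm u (p1 ++ y :: p2) y = last u p1.
Proof.
elim: p1 u => [|x p1 IHp] u /=.
  by case/andP=> uy _; rewrite permM tpermR path_perm_out.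
case/andP=> un /andP[xn U]; rewrite permM tpermD; last first.
- by apply: contraNneq xn => ->; rewrite mem_cat mem_head orbT.
- by apply: contraNneq un => ->; rewrite inE mem_cat mem_head !orbT.
by apply: IHp; rewrite /= xn.
Qed.

Lemma next_cat (l1 l2 : seq T) (a b : T) : uniq (l1 ++ a :: b :: l2) ->
  next (l1 ++ a :: b :: l2) a = b.
Proof.
move=> U; rewrite next_nth mem_cat mem_head orbT.
case: l1 U => [|c l1] /= U; first by rewrite eqxx.
have ca : c == a = false.
  apply: contraTF U => /eqP ->.
  by rewrite mem_cat mem_head orbT.
rewrite ca index_cat; case: ifP => [al|_].
  by move: U => /andP[_]; rewrite cat_uniq /= al andbF.
by rewrite /= eqxx addn0 nth_cat ltnNge leqnSn /= subSnn.
Qed.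

Lemma next_last (x : T) l : uniq (x :: l) -> next (x :: l) (last x l) = x.
Proof.
move=> U; rewrite next_nth mem_last.
by rewrite index_last // nth_default.
Qed.
End HoleWalks.

(** * Commutators of two overlapping cycles *)

Section CyclePerms.
Variable T : finType.
Implicit Types (u x y z w t : T) (xs zs l p : seq T) (a s : {perm T}).
Local Open Scope group_scope.

Lemma next_out p t : t \notin p -> next p t = t.
Proof. by move=> tp; rewrite next_nth (negbTE tp). Qed.

Lemma split_not_last x l t : t \in x :: l -> t != last x l ->
  exists l1 b l2, x :: l = l1 ++ t :: b :: l2.
Proof.
case/splitPr e: _ / => [l1 [|b l2]].
  by move: e => /(congr1 (last x)) /=; rewrite last_cat /= => ->; rewrite eqxx.
by exists l1, b, l2.
Qed.

Lemma next_left x xs l t : uniq ((x :: xs) ++ l) -> t \in x :: xs ->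
  t != last x xs -> next ((x :: xs) ++ l) t \in x :: xs.
Proof.
move=> U tx /(split_not_last tx)[l1 [b [l2 e]]]; move: U; rewrite e -catA /= => U.
by rewrite next_cat // mem_cat !inE eqxx !orbT.
Qed.

Lemma next_mid x xs w l : uniq ((x :: xs) ++ w :: l) ->
  next ((x :: xs) ++ w :: l) (last x xs) = w.
Proof. by rewrite lastI cat_rcons => U; rewrite next_cat. Qed.

Lemma next_wrap x xs w l : uniq ((x :: xs) ++ w :: l) ->
  next ((x :: xs) ++ w :: l) (last w l) = x.
Proof.
move=> U; have := next_last U; rewrite /= last_cat /=; exact.
Qed.

Lemma next_right w l t : t \in w :: l -> t != last w l ->
  exists2 t', t' \in w :: l &
    forall xs, uniq (xs ++ w :: l) -> next (xs ++ w :: l) t = t'.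
Proof.
move=> tx /(split_not_last tx)[l1 [b [l2 ->]]]; exists b.
  by rewrite mem_cat !inE eqxx !orbT.
by move=> xs; rewrite catA => U; rewrite next_cat.
Qed.

(** * Commutator of two cyclic permutations that share the arc [w :: l] *)

Section Commutator.
Variables (a b : {perm T}) (x : T) (xs : seq T) (z : T) (zs : seq T).
Variables (w : T) (l : seq T).
Hypothesis U : uniq ((x :: xs) ++ (z :: zs) ++ w :: l).
Hypothesis aE : a =1 next ((x :: xs) ++ w :: l).
Hypothesis bE : b =1 next ((z :: zs) ++ w :: l).

Let Ux : uniq ((x :: xs) ++ w :: l).
Proof.
apply: subseq_uniq U; apply: cat_subseq => //; exact: suffix_subseq.
Qed.

Let Uz : uniq ((z :: zs) ++ w :: l).
Proof. by apply: subseq_uniq U; apply: suffix_subseq. Qed.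

Let dxz t : t \in x :: xs -> t \notin z :: zs.
Proof.
move: U; rewrite cat_uniq has_cat negb_or => /and3P[_ /andP[/hasPn A _] _] tx.
by apply/negP => /A /=; rewrite tx.
Qed.

Let dxw t : t \in x :: xs -> t \notin w :: l.
Proof.
move: Ux; rewrite cat_uniq => /and3P[_ /hasPn A _] tx.
by apply/negP => /A /=; rewrite tx.
Qed.

Let dzw t : t \in z :: zs -> t \notin w :: l.
Proof.
move: Uz; rewrite cat_uniq => /and3P[_ /hasPn A _] tx.
by apply/negP => /A /=; rewrite tx.
Qed.

Let bX t : t \in x :: xs -> b t = t.
Proof.
by move=> tx; rewrite bE next_out // mem_cat negb_or dxz // dxw.
Qed.

Let aZ t : t \in z :: zs -> a t = t.
Proof.
move=> tz; rewrite aE next_out // mem_cat negb_or dzw // andbT.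
by apply/negP => /dxz; rewrite tz.
Qed.

Let aX t : t \in x :: xs -> t != last x xs -> a t \in x :: xs.
Proof. by move=> tx tl; rewrite aE next_left. Qed.

Let bZ t : t \in z :: zs -> t != last z zs -> b t \in z :: zs.
Proof. by move=> tx tl; rewrite bE next_left. Qed.

Let a_mid : a (last x xs) = w. Proof. by rewrite aE next_mid. Qed.
Let b_mid : b (last z zs) = w. Proof. by rewrite bE next_mid. Qed.
Let a_wrap : a (last w l) = x. Proof. by rewrite aE next_wrap. Qed.
Let b_wrap : b (last w l) = z. Proof. by rewrite bE next_wrap. Qed.

Let abW t : t \in w :: l -> t != last w l -> (a t \in w :: l) && (b t == a t).
Proof.
move=> tw /(next_right tw)[t' t'w H].
by rewrite aE bE !H // t'w eqxx.
Qed.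

Let ab_out t : t \notin x :: xs -> t \notin z :: zs -> t \notin w :: l ->
  a t = t /\ b t = t.
Proof.
move=> tx tz tw; rewrite aE bE.
by split; apply: next_out; rewrite mem_cat negb_or ?tx ?tz tw.
Qed.

Let xz : x != z.
Proof. by have := dxz (mem_head x xs); apply: contraNneq => ->; rewrite mem_head. Qed.

Let xw : x != w.
Proof. by have := dxw (mem_head x xs); apply: contraNneq => ->; rewrite mem_head. Qed.

Let zw : z != w.
Proof. by have := dzw (mem_head z zs); apply: contraNneq => ->; rewrite mem_head. Qed.

Let lastw : last w l \in w :: l. Proof. exact: mem_last. Qed.

Let a_neq_x t : t \notin w :: l -> x != a t.
Proof.
apply: contraNneq => e; have/perm_inj -> // : a t = a (last w l).
by rewrite a_wrap.
Qed.

Let b_neq_z t : t \notin w :: l -> z != b t.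
Proof.
apply: contraNneq => e; have/perm_inj -> // : b t = b (last w l).
by rewrite b_wrap.
Qed.

(** The commutator corrects [b * a] to [a * b], so below both products are compared point by point
    on the private arcs, the shared arc and the rest. *)
Let commgE_mul s : a * b = b * a * s -> [~ a, b] = s.
Proof. by move=> E; rewrite commgEl conjgE !mulgA -mulgA E -invMg mulKg. Qed.

Let neq_in (s : seq T) t t' : t \in s -> t' \notin s -> t != t'.
Proof. by move=> ts; apply: contraNneq => <-. Qed.

(** The shared arc is the point [w]; the two products differ only at the ends of the private arcs
    and at [w]. *)
Lemma commutator_cycle3 : l = [::] -> [~ a, b] = cycle3 x w z.
Proof.
move=> l0; apply: commgE_mul.
have aw : a w = x by rewrite -a_wrap l0.
have bw : b w = z by rewrite -b_wrap l0.
have wl : w \in w :: l by rewrite mem_head.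
apply/permP => t; rewrite (permM a b) (permM (b * a)) (permM b a).
have [tx|tx] := boolP (t \in x :: xs).
  rewrite (bX tx); have [->|tl] := eqVneq t (last x xs).
    by rewrite a_mid bw cycle3_2.
  have ax := aX tx tl; rewrite (bX ax) cycle3D ?a_neq_x ?dxw //.
    by rewrite (neq_in wl) ?dxw.
  by rewrite (neq_in (mem_head z zs)) ?dxz.
have [tz|tz] := boolP (t \in z :: zs).
  rewrite (aZ tz); have [->|tl] := eqVneq t (last z zs).
    by rewrite b_mid aw cycle3_1 // eq_sym.
  have bz := bZ tz tl; rewrite (aZ bz) cycle3D ?b_neq_z ?dzw //.
    by rewrite (neq_in (mem_head x xs)) //; apply: contraL bz => /dxz.
  by rewrite (neq_in wl) ?dzw.
have [tw|tw] := boolP (t \in w :: l).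
  move: tw; rewrite l0 inE => /eqP ->; rewrite aw bw bX ?mem_head // aZ ?mem_head //.
  by rewrite cycle3_3 // eq_sym.
have [at_ bt_] := ab_out tx tz tw; rewrite at_ bt_ at_.
rewrite cycle3D //; first exact: neq_in (mem_head _ _) tx.
  exact: neq_in (mem_head _ _) tw.
exact: neq_in (mem_head _ _) tz.
Qed.

(** On the shared arc [a] and [b] agree except at its last point, so the two products differ only at
    the ends of the private arcs and at the last two shared points. *)
Lemma commutator_double y l' : l = y :: l' ->
  [~ a, b] = tperm x z * tperm w y.
Proof.
move=> le; apply: commgE_mul.
have wl : w \in w :: l by rewrite mem_head.
have yl : y \in w :: l by rewrite le !inE eqxx orbT.
have wlast : w != last w l.
  move: Uz; rewrite le cat_uniq => /and3P[_ _ /= /andP[wy _]].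
  by apply: contraNneq wy => ->; apply: mem_last.
have aw : a w = y.
  have := next_cat (l1 := x :: xs) (a := w) (b := y) (l2 := l').
  by rewrite aE le; apply; rewrite -le.
have bw : b w = y by have /andP[_ /eqP ->] := abW wl wlast.
have DE t : t \notin [:: x; z; w; y] -> (tperm x z * tperm w y) t = t.
  rewrite !inE !negb_or => /and4P[tx tz tw ty].
  by rewrite permM !tpermD // eq_sym.
have DX : (tperm x z * tperm w y) x = z.
  by rewrite permM tpermL tpermD // eq_sym ?zw // (neq_in (mem_head z zs)) // -?le;
     apply/negP => /dzw; rewrite yl.
have DZ : (tperm x z * tperm w y) z = x.
  by rewrite permM tpermR tpermD // eq_sym ?xw // (neq_in (mem_head x xs)) // -?le;
     apply/negP => /dxw; rewrite yl.
have DW : (tperm x z * tperm w y) w = y by rewrite permM (tpermD xw zw) tpermL.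
have DY : (tperm x z * tperm w y) y = w.
  rewrite permM [tperm x z y]tpermD ?tpermR //.
    by apply: neq_in (mem_head x xs) _; apply/negP => /dxw; rewrite yl.
  by apply: neq_in (mem_head z zs) _; apply/negP => /dzw; rewrite yl.
move: (tperm x z * tperm w y) DE DX DZ DW DY => D DE DX DZ DW DY.
apply/permP => t; rewrite !permM.
have [tx|tx] := boolP (t \in x :: xs).
  rewrite (bX tx); have [->|tl] := eqVneq t (last x xs).
    by rewrite a_mid bw DW.
  have ax := aX tx tl; rewrite (bX ax) DE // !inE !negb_or.
  rewrite [_ == x]eq_sym a_neq_x ?dxw //.
  rewrite !(eq_sym (a t)) (neq_in (mem_head z zs)) ?dxz //.
  by rewrite (neq_in wl) ?dxw // (neq_in yl) ?dxw.
have [tz|tz] := boolP (t \in z :: zs).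
  rewrite (aZ tz); have [->|tl] := eqVneq t (last z zs).
    by rewrite b_mid aw DY.
  have bz := bZ tz tl; rewrite (aZ bz) DE // !inE !negb_or.
  rewrite [_ == z]eq_sym b_neq_z ?dzw //.
  rewrite !(eq_sym (b t)) (neq_in (mem_head x xs)); last first.
    by apply: contraL bz => /dxz.
  by rewrite (neq_in wl) ?dzw // (neq_in yl) ?dzw.
have [tw|tw] := boolP (t \in w :: l); last first.
  have [at_ bt_] := ab_out tx tz tw; rewrite at_ bt_ at_ DE // !inE !negb_or ![t == _]eq_sym.
  by rewrite !(neq_in (mem_head _ _) tx) !(neq_in (mem_head _ _) tz)
             !(neq_in wl tw) !(neq_in yl tw).
have [->|tl] := eqVneq t (last w l).
  by rewrite a_wrap b_wrap bX ?mem_head // aZ ?mem_head // DZ.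
have /andP[atw /eqP ->] := abW tw tl.
have [->|atl] := eqVneq (a t) (last w l); first by rewrite b_wrap a_wrap DX.
have /andP[aatw /eqP ->] := abW atw atl.
have atNw : a t != w.
  by rewrite -a_mid (inj_eq perm_inj); apply: contraTneq tw => ->; rewrite dxw // mem_last.
rewrite DE // !inE !negb_or.
rewrite -{1}a_mid -aw !(inj_eq perm_inj) atNw andbT.
apply/and3P; split.
- by apply: contraTneq aatw => ->; rewrite dxw // mem_head.
- by apply: contraTneq aatw => ->; rewrite dzw // mem_head.
- by apply: contraTneq atw => ->; rewrite dxw // mem_last.
Qed.
End Commutator.
End CyclePerms.

(** * Theta graphs *)

Section Theta.
Variables (T : finType) (G : sgraph T).
Implicit Types (u w x y z t : T) (l p : seq T) (a s : {perm T}).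
Local Open Scope group_scope.

Lemma tperm_commute x y z t : uniq [:: x; y; z; t] ->
  commute (tperm x y) (tperm z t).
Proof.
rewrite /= !inE !negb_or => /and4P[/and3P[_ xz xt] /andP[yz yt] _ _].
by apply: commute_sym; apply/commgP/conjg_fixP; rewrite tpermJ !tpermD.
Qed.

Lemma next_nthS x0 p j : uniq p -> j < size p ->
  next p (nth x0 p j) = nth x0 p (j.+1 %% size p).
Proof.
move=> U jp; rewrite next_nth mem_nth // index_uniq //.
case: p U jp => [//|y p] U jp.
have [je|jn] := eqVneq j.+1 (size (y :: p)).
  by rewrite je modnn /= nth_default //; move: je => /= [->].
have jl : j.+1 < size (y :: p) by rewrite ltn_neqAle jn.
by rewrite (modn_small jl) /=; apply: set_nth_default.
Qed.

(** The hole tours the cycle once. The tour along [p] pulls the tokens backwards, so its inverse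
    advances them by [next p], skipping the place [u] of the hole. *)
Lemma cycle_walk u p : uniq (u :: p) -> path.cycle G (u :: p) ->
  exists2 s, hole_walk G u u s & s =1 next p.
Proof.
move=> U; rewrite /path.cycle rcons_path => /andP[up lu].
exists (path_perm u p * tperm (last u p) u)^-1.
  apply: hole_walkV; apply: hole_walkM (path_perm_walk up) _.
  exact: hole_walk_adj.
suff H t : (path_perm u p * tperm (last u p) u) (next p t) = t.
  by move=> t; rewrite -{1}(H t) permK.
rewrite permM; have [tp|tp] := boolP (t \in p); last first.
  rewrite next_out //; have [->|tu] := eqVneq t u.
    by rewrite (hole_walk_end (path_perm_walk up)) tpermL.
  rewrite path_perm_out ?inE ?negb_or ?tu // tpermD // 1?eq_sym //.
  have := mem_last u p; rewrite inE => /orP[/eqP->//|lp].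
  by apply: contraNneq tp => ->.
case: p U up lu tp => [//|x p] U up lu tp.
have tu : t != u by move: U => /= /andP[un _]; apply: contraNneq un => <-.
have [->|tl] := eqVneq t (last x p).
  rewrite next_last; last by case/andP: U.
  by rewrite (path_perm_in (p1 := [::])) //= tpermR.
have [l1 [b [l2 e]]] := split_not_last tp tl.
have e' : x :: p = rcons l1 t ++ b :: l2 by rewrite cat_rcons.
rewrite [in next _ _]e next_cat -?e //; last by case/andP: U.
by rewrite e' path_perm_in -?e' // last_rcons tpermD // eq_sym.
Qed.

(** Three internally disjoint paths from [u] to [w], given by their inner vertices; the size
    conditions allow at most one of them to be a bare edge. *)
Definition theta u w l1 l2 l3 : bool :=
  [&& uniq (u :: w :: l1 ++ l2 ++ l3),
      path G u (rcons l1 w), path G u (rcons l2 w), path G u (rcons l3 w),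
      0 < size l1 + size l2, 0 < size l1 + size l3 & 0 < size l2 + size l3].

Lemma theta12 u w l1 l2 l3 : theta u w l1 l2 l3 -> theta u w l2 l1 l3.
Proof.
case/and5P=> U P1 P2 P3 /and3P[s12 s13 s23]; rewrite /theta P1 P2 P3 s13 s23 addnC s12.
rewrite (perm_uniq (_ : perm_eq _ (u :: w :: l1 ++ l2 ++ l3))) ?U //.
by rewrite !perm_cons perm_catCA.
Qed.

Lemma theta23 u w l1 l2 l3 : theta u w l1 l2 l3 -> theta u w l1 l3 l2.
Proof.
case/and5P=> U P1 P2 P3 /and3P[s12 s13 s23]; rewrite /theta P1 P2 P3 s12 s13 addnC s23.
rewrite (perm_uniq (_ : perm_eq _ (u :: w :: l1 ++ l2 ++ l3))) ?U //.
by rewrite !perm_cons perm_cat2l perm_catC.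
Qed.

Lemma path_rcons_rev u w l : path G u (rcons l w) = path G w (rcons (rev l) u).
Proof.
rewrite -rev_path last_rcons belast_rcons rev_cons.
by apply: eq_path => x y; rewrite /= adj_sym.
Qed.

(** The lists are ordered as in the commutator lemmas: private arcs [l1] and [l3], shared arc
    [w :: rev l2], and the hole [u] off all of them. *)
Lemma theta_uniq u w l1 l2 l3 : theta u w l1 l2 l3 ->
  uniq (l1 ++ l3 ++ w :: rev l2) && (u \notin l1 ++ l3 ++ w :: rev l2).
Proof.
case/andP=> U _; rewrite andbC -cons_uniq.
rewrite (perm_uniq (_ : perm_eq _ (u :: w :: l1 ++ l2 ++ l3))) ?U //.
by apply/seq.permP => P; rewrite /= !count_cat /= count_rev; lia.
Qed.

Lemma theta_walk u w l1 l2 l3 : theta u w l1 l2 l3 ->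
  exists2 s, hole_walk G u u s & s =1 next (l1 ++ w :: rev l2).
Proof.
move=> th; have /andP[U un] := theta_uniq th; case/and5P: th => _ P1 P2 _ _.
apply: cycle_walk; last first.
  rewrite /path.cycle rcons_cat rcons_cons -cat_rcons cat_path P1 last_rcons.
  by rewrite -path_rcons_rev.
have sb : subseq (l1 ++ w :: rev l2) (l1 ++ l3 ++ w :: rev l2).
  by apply: cat_subseq => //; apply: suffix_subseq.
rewrite /= (subseq_uniq sb U) andbT; apply: contra un; exact: mem_subseq.
Qed.

Lemma theta_cycle3 u w x xs z zs : theta u w (x :: xs) [::] (z :: zs) ->
  hole_walk G u u (cycle3 x w z).
Proof.
move=> th; have /andP[U _] := theta_uniq th.
(* The three swaps exchange [l1] and [l3], which gives the other cycle through the same [l2]. *)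
have [a Wa aE] := theta_walk th; have [b Wb bE] := theta_walk (theta12 (theta23 (theta12 th))).
rewrite -(commutator_cycle3 U aE bE (erefl _)) commgEl.
by apply: hole_walkM (hole_walkV Wa) (hole_walk_conj Wb Wa).
Qed.

Lemma theta_double u w x xs ys y z zs : theta u w (x :: xs) (rcons ys y) (z :: zs) ->
  hole_walk G u u (tperm x z * tperm w y).
Proof.
move=> th; have /andP[U _] := theta_uniq th.
have [a Wa aE] := theta_walk th; have [b Wb bE] := theta_walk (theta12 (theta23 (theta12 th))).
rewrite -(commutator_double U aE bE (rev_rcons _ _)) commgEl.
by apply: hole_walkM (hole_walkV Wa) (hole_walk_conj Wb Wa).
Qed.

Definition all_related u l : Prop := {in l &, forall x y, related G u x y}.

Lemma all_related_sub u l l' : {subset l' <= l} -> all_related u l -> all_related u l'.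
Proof. by move=> sub A x y /sub xl /sub yl; apply: A. Qed.

Lemma all_related_root u l t : {in l, forall x, related G u t x} -> all_related u l.
Proof.
move=> A x y xl yl; apply: related_trans (A _ yl).
exact: related_sym (A _ xl).
Qed.

Section Rotation.
Variables (u : T) (a : {perm T}) (p : seq T).
Hypotheses (Wa : hole_walk G u u a) (aE : a =1 next p) (Up : uniq p).

Lemma rotX e j x0 : j < size p -> (a ^+ e) (nth x0 p j) = nth x0 p ((j + e) %% size p).
Proof.
move=> jp; elim: e => [|e IHe]; first by rewrite perm1 addn0 modn_small.
rewrite expgSr permM IHe aE next_nthS // ?ltn_mod; last exact: leq_ltn_trans jp.
by rewrite addnS -addn1 modnDml addn1.
Qed.

Lemma rotX_out e t : t \notin p -> (a ^+ e) t = t.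
Proof.
move=> tp; elim: e => [|e IHe]; first by rewrite perm1.
by rewrite expgSr permM IHe aE next_out.
Qed.

Lemma mem_rot_ex x y : x \in p -> y \in p -> exists e, (a ^+ e) x = y.
Proof.
move=> xp yp; exists (index y p + size p - index x p).
move: (xp) (yp); rewrite -!index_mem => ix iy.
have := rotX (index y p + size p - index x p) x ix; rewrite nth_index // => ->.
by rewrite subnKC 1?ltnW ?ltn_addl // modnDr modn_small // nth_index.
Qed.

(** Powers of [a] fix [t] and move [x] to every place of [p]. *)
Lemma spread_out t x : t \notin p -> x \in p -> related G u t x ->
  all_related u (t :: p).
Proof.
move=> tp xp R; apply: (@all_related_root _ _ t) => y; rewrite inE.
case/orP=> [/eqP->|yp]; first exact: relatedxx.
have [e <-] := mem_rot_ex xp yp.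
by rewrite -{1}(rotX_out e tp); apply: related_walk R; apply: hole_walkX.
Qed.

(** Rotating the relation gives it for all consecutive places of [p], and transitivity does the
    rest. *)
Lemma spread_next x : x \in p -> related G u x (a x) -> all_related u p.
Proof.
move=> xp R; apply: (@all_related_root _ _ x) => y yp.
have [e <-] := mem_rot_ex xp yp; elim: e => [|e IHe].
  by rewrite perm1 relatedxx.
apply: related_trans IHe _; rewrite expgS permM.
by apply: related_walk R; apply: hole_walkX.
Qed.
End Rotation.

(** The cycle through [l3] and [l2] contains [w] followed by the last vertex of [l2], a pair already
    related, so it is related throughout; the two cycles share [w]. *)
Lemma theta_spread u w l1 l2 l3 : theta u w l1 l2 l3 -> l2 <> [::] ->
  all_related u (l1 ++ w :: rev l2) -> all_related u (w :: l1 ++ l2 ++ l3).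
Proof.
move=> th l2n A; have th' := theta12 (theta23 (theta12 th)).
have [b Wb bE] := theta_walk th'.
have /andP[Ub _] := theta_uniq th'.
have Ub' : uniq (l3 ++ w :: rev l2).
  by apply: subseq_uniq Ub; apply: cat_subseq => //; apply: suffix_subseq.
have B : all_related u (l3 ++ w :: rev l2).
  case/lastP: l2 l2n th th' A b Wb bE Ub Ub' => [//|l2 y] _ th th' A b Wb bE Ub Ub'.
  apply: (spread_next Wb bE Ub' (x := w)); first by rewrite mem_cat mem_head orbT.
  move: (Ub'); rewrite bE rev_rcons => /next_cat ->.
  by apply: A; rewrite rev_rcons mem_cat !inE eqxx ?orbT.
apply: (@all_related_root _ _ w) => x; rewrite inE !mem_cat.
case/or4P=> [/eqP->|x1|x2|x3]; first exact: relatedxx.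
- by apply: A; rewrite mem_cat ?x1 // mem_head orbT.
- by apply: A; rewrite mem_cat inE ?mem_rev ?x2 ?orbT // eqxx orbT.
- by apply: B; rewrite mem_cat ?x3 // mem_head orbT.
Qed.

(** The commutator is a 3-cycle on [x], [w], [z], where [x] and [z] begin the two long paths. As [z]
    lies off the cycle through [l1] and [x] off the one through [l3], each spreads its relation to
    [w] over the cycle it avoids. *)
Lemma theta_related_0 u w l1 l3 : theta u w l1 [::] l3 ->
  all_related u (w :: l1 ++ l3).
Proof.
case: l1 => [|x xs]; first by rewrite /theta !andbF.
case: l3 => [|z zs]; first by rewrite /theta !andbF.
move=> th; have W := theta_cycle3 th.
have /andP[U _] := theta_uniq th.
have U3 : uniq [:: x; z; w].
  apply: subseq_uniq U; apply: (@cat_subseq _ [:: x] [:: z; w]).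
    by rewrite sub1seq mem_head.
  by apply: (@cat_subseq _ [:: z] [:: w]); rewrite sub1seq mem_head.
have U3' : uniq [:: x; w; z].
  by rewrite (perm_uniq (_ : perm_eq _ [:: x; z; w])) //; apply/seq.permP=> P /=; lia.
have xw := cycle3_related U3' W.
have wz : related G u w z.
  by move: W; rewrite cycle3_rot //; apply: cycle3_related; rewrite -(rot_uniq 2).
have half l l' x' z' : theta u w (x' :: l) [::] (z' :: l') -> related G u z' w ->
    all_related u (w :: x' :: l).
  move=> th' R; have /andP[U' _] := theta_uniq th'.
  have [a Wa aE] := theta_walk th'.
  apply: (@all_related_sub _ (z' :: (x' :: l) ++ [:: w])).
    by move=> t; rewrite !(inE, mem_cat) => /or3P[]->; rewrite ?orbT.
  apply: (spread_out Wa aE _ _ (x := w)) => //.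
  - by apply: subseq_uniq U'; apply: cat_subseq => //; apply: suffix_subseq.
  - move: U'; rewrite (perm_uniq (_ : perm_eq _ (z' :: ((x' :: l) ++ [:: w]) ++ l'))).
      by case/andP=> + _; rewrite mem_cat => /norP[].
    by apply/seq.permP => P; rewrite /= !count_cat /= ?count_cat /= ?count_cat /=; clear; lia.
  - by rewrite mem_cat mem_head orbT.
have A := half _ _ _ _ th (related_sym wz).
have B := half _ _ _ _ (theta12 (theta23 (theta12 th))) xw.
apply: (@all_related_root _ _ w) => t; rewrite inE mem_cat orbA.
case/orP=> tin; first by apply: A; rewrite ?mem_head // inE.
by apply: B; rewrite ?mem_head // inE tin orbT.
Qed.
End Theta.

(** * Theta graphs in which all three paths have inner vertices *)

Section ThetaLong.
Variables (T : finType) (G : sgraph T) (u w : T) (l1 l2 l3 : seq T).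
Hypothesis th : theta G u w l1 l2 l3.
Hypotheses (l1n : 0 < size l1) (l2n : 0 < size l2) (l3n : 0 < size l3).
Local Open Scope group_scope.

Let p := l1 ++ w :: rev l2.
Let a := size l1.
Let L := a + size l2 + 1.
(** The places of the cycle through [l1] and [l2], numbered modulo its token count: [P 0] begins
    [l1], [P a] is [w], [P (a + 1)] ends [l2] and [P (L - 1)] begins [l2]. *)
Let P i := nth u p (i %% L).
Let z := head u l3.

Let size_p : size p = L.
Proof. by rewrite size_cat /= size_rev /L addnS addn1. Qed.

Let p_uniq : uniq p.
Proof.
have /andP[U _] := theta_uniq th.
by apply: subseq_uniq U; apply: cat_subseq => //; apply: suffix_subseq.
Qed.

Let l3_out t : t \in l3 -> t \notin p.
Proof.
have /andP[U _] := theta_uniq th; move: U.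
rewrite (perm_uniq (_ : perm_eq _ (p ++ l3))).
  by rewrite cat_uniq => /and3P[_ /hasPn H _] /H.
by apply/seq.permP => Q; rewrite !count_cat /=; lia.
Qed.

Let l3_uniq : uniq l3.
Proof.
have /andP[U _] := theta_uniq th; apply: subseq_uniq U.
by apply: subseq_trans (suffix_subseq _ _); apply: prefix_subseq.
Qed.

Let L_gt0 : 0 < L. Proof. by rewrite /L addn1. Qed.

Let P_in i : P i \in p.
Proof. by rewrite mem_nth // size_p ltn_mod /L addn1. Qed.

(** Restricting indices to below [L + L] turns distinctness modulo [L] into linear arithmetic. *)
Let P_neq i j : i < L + L -> j < L + L -> i != j -> i != j + L -> j != i + L ->
  P i != P j.
Proof.
have modE k : k < L + L -> (k %% L = k \/ k %% L + L = k)%N.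
  case: (ltnP k L) => [/modn_small->|Lk kL]; first by left.
  by right; rewrite -{1}(subnK Lk) modnDr modn_small; lia.
move=> iL jL ij ijL jiL; rewrite nth_uniq ?size_p ?ltn_mod //.
by have := modE i iL; have := modE j jL; lia.
Qed.

Let P_per i : P (i + L) = P i.
Proof. by rewrite /P modnDr. Qed.

Let P0 : P 0 = head u l1.
Proof. by rewrite /P mod0n /p; case: l1 l1n. Qed.

Let Pa : P a = w.
Proof. by rewrite /P modn_small ?/p ?nth_cat ?ltnn ?subnn // /L; lia. Qed.

Let PaS : P (a + 1) = last u l2.
Proof.
rewrite /P modn_small; last by rewrite /L; lia.
rewrite /p nth_cat ltnNge leq_addr /= addKn /=.
by case/lastP: l2 l2n => // l y _; rewrite rev_rcons last_rcons.
Qed.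

Let PL : P (L - 1) = head u l2.
Proof.
rewrite /P modn_small; last by rewrite /L; lia.
rewrite /p nth_cat ifF; last by rewrite /L; lia.
have -> : L - 1 - size l1 = size l2 by rewrite /L /a; lia.
case: l2 l2n => // y l _; rewrite rev_cons /= nth_rcons size_rev ltnn eqxx //.
Qed.

Let z_in : z \in l3.
Proof. by rewrite /z; case: l3 l3n => // y l _; rewrite mem_head. Qed.

Let zc_in : last u l3 \in l3.
Proof. by case/lastP: l3 l3n => // l y _; rewrite last_rcons mem_rcons mem_head. Qed.

Let l3_neq t i : t \in l3 -> t != P i.
Proof. by move/l3_out; apply: contraNneq => ->; apply: P_in. Qed.

Let conj_rot s e : hole_walk G u u s ->
  exists2 g : {perm T}, (forall i, i < L -> g (P i) = P (i + e)) &
  (forall t, t \in l3 -> g t = t) /\ hole_walk G u u (s ^ g).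
Proof.
move=> Ws; have [b Wb bE] := theta_walk th; exists (b ^+ e); last split.
- move=> i iL; rewrite /P (modn_small iL) (rotX bE p_uniq) ?size_p //.
- by move=> t /l3_out; apply: rotX_out.
- by apply: hole_walk_conj Ws; apply: hole_walkX.
Qed.

(** The commutator of the two cycles sharing [l2], conjugated by a power of the rotation; [double2]
    does the same for the two cycles sharing [l3]. *)
Let double1 e : hole_walk G u u (tperm (P e) z * tperm (P (a + e)) (P (a + 1 + e))).
Proof.
have W : hole_walk G u u (tperm (P 0) z * tperm (P a) (P (a + 1))).
  rewrite P0 Pa PaS /z; move: th.
  case: l1 l1n => // x xs _; case: l3 l3n => // z' zs _.
  by case/lastP: l2 l2n => // l y _; rewrite last_rcons /=; apply: theta_double.
have [g gP [gz]] := conj_rot e W.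
by rewrite conjMg !tpermJ !gP ?gz // /L; lia.
Qed.

Let double2 e : hole_walk G u u (tperm (P e) (P (L - 1 + e)) * tperm (P (a + e)) (last u l3)).
Proof.
have W : hole_walk G u u (tperm (P 0) (P (L - 1)) * tperm (P a) (last u l3)).
  rewrite P0 Pa PL; move: (theta23 th).
  case: l1 l1n => // x xs _; case: l2 l2n => // z' zs _.
  by case/lastP: l3 l3n => // l y _; rewrite last_rcons /=; apply: theta_double.
have [g gP [gz]] := conj_rot e W.
by rewrite conjMg !tpermJ !gP ?gz // /L; lia.
Qed.

Let finish t i : t \in l3 -> related G u t (P i) -> all_related G u (w :: l1 ++ l2 ++ l3).
Proof.
move=> tl R; apply: (theta_spread th); first by case: l2 l2n.
have [b Wb bE] := theta_walk th.
apply: all_related_sub (spread_out Wb bE p_uniq (l3_out tl) (P_in i) R).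
by move=> x xp; rewrite inE xp orbT.
Qed.

Let finish_next i : related G u (P i) (P i.+1) -> all_related G u (w :: l1 ++ l2 ++ l3).
Proof.
move=> R; apply: (theta_spread th); first by case: l2 l2n.
have [b Wb bE] := theta_walk th.
apply: (spread_next Wb bE p_uniq (P_in i)).
have L0 : 0 < L by rewrite /L addn1.
rewrite bE /P next_nthS // size_p ?ltn_mod //.
by have -> : (i %% L).+1 %% L = i.+1 %% L by rewrite -addn1 modnDml addn1.
Qed.

(** The cycle carries just three tokens, so the tour around it is already a 3-cycle. *)
Lemma theta_related_11 : size l1 = 1%N -> size l2 = 1%N ->
  all_related G u (w :: l1 ++ l2 ++ l3).
Proof.
move=> s1 s2; have [b Wb bE] := theta_walk th.
have L3 : L = 3 by rewrite /L /a s1 s2.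
have U : uniq [:: P 0; P 1; P 2].
  by rewrite uniq3 !P_neq // L3.
apply: (@finish_next 0); apply: (cycle3_related U).
suff -> : cycle3 (P 0) (P 1) (P 2) = b by [].
move: (U); rewrite uniq3 => /and3P[U1 U2 U3].
have bP i : i < 3 -> b (P i) = P (i + 1).
  move=> i3; rewrite /P L3 (modn_small i3) bE next_nthS ?size_p ?L3 //.
  by rewrite addn1.
apply/permP => t; have [tp|tp] := boolP (t \in p); last first.
  rewrite bE next_out // cycle3D //; apply: contraNneq tp => <-; exact: P_in.
have : t \in map P (iota 0 3).
  move: tp => /(nthP u)[i]; rewrite size_p L3 => i3 <-.
  by apply/mapP; exists i; rewrite ?mem_iota // /P L3 modn_small.
rewrite /= !inE => /or3P[]/eqP->; rewrite bP //.
- by rewrite cycle3_1.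
- by rewrite cycle3_2.
- by rewrite cycle3_3 // /P L3.
Qed.

(* The square of the product of [double1 0] and [double1 e] is a 3-cycle, since
   its two transpositions among the [P i] are disjoint from the rest. *)
Lemma theta_related_far e : 2 <= e -> e <= size l1 + size l2 - 1 ->
  e != size l1 -> e != size l1 + 1 -> e != size l2 -> e != size l2 + 1 ->
  all_related G u (w :: l1 ++ l2 ++ l3).
Proof.
rewrite -/a => e2 eL ea ea1 eb eb1.
have := hole_walkM (double1 0) (double1 e); rewrite !addn0.
set A := tperm (P 0) z; set B := tperm (P a) _.
set C := tperm (P e) z; set E := tperm (P (a + e)) _ => W.
have zP i : (z == P i) = false by apply/negbTE; apply: l3_neq z_in.
have Pz i : (P i == z) = false by rewrite eq_sym zP.
have bd : [&& 0 < a, a + 1 < L, e < L & a + 1 + e < L + L] by rewrite /L; lia.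
have BC : commute B C.
  by apply: tperm_commute; rewrite /= !inE !negb_or !Pz !P_neq /L; lia.
have BA : commute B A.
  by apply: tperm_commute; rewrite /= !inE !negb_or !Pz !P_neq /L; lia.
have EA : commute E A.
  by apply: tperm_commute; rewrite /= !inE !negb_or !Pz !P_neq /L; lia.
have EC : commute E C.
  by apply: tperm_commute; rewrite /= !inE !negb_or !Pz !P_neq /L; lia.
have BE : commute B E.
  by apply: tperm_commute; rewrite /= !inE !negb_or !P_neq /L; lia.
have eW : A * B * (C * E) = A * C * (B * E).
  by rewrite -!mulgA; congr (_ * _); rewrite !mulgA BC.
have cm : commute (A * C) (B * E).
  apply: commuteM; apply: commute_sym; apply: commuteM => //.
have AC : A * C = cycle3 z (P 0) (P e) by rewrite /cycle3 [tperm z _]tpermC [tperm z _]tpermC.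
have U3 : uniq [:: z; P 0; P e] by rewrite uniq3 !zP P_neq /L; lia.
have := hole_walkM W W; rewrite eW -expg2 expgMn // (expgMn _ BE).
rewrite !expg2 !tperm2 mul1g mulg1 AC (cycle3_sqr U3) => /cycle3_related R.
by apply: (finish z_in (R _)); rewrite uniq3 !zP P_neq /L; lia.
Qed.

(** Here [L] is [2 * a + 1], and after a shift by [a + 1] both double transpositions contain the
    pair [P a], [P (a + 1)]. It cancels, leaving two transpositions that meet in [P 0] and reach the
    two ends of [l3]. *)
Lemma theta_related_eq : size l1 = size l2 -> 1 < size l3 ->
  all_related G u (w :: l1 ++ l2 ++ l3).
Proof.
move=> s12 s3; have := hole_walkM (double1 0) (double2 (a + 1)); rewrite !addn0.
have -> : P (L - 1 + (a + 1)) = P a by rewrite -[RHS]P_per; congr P; rewrite /L /a; lia.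
have -> : P (a + (a + 1)) = P 0 by rewrite -[RHS]P_per; congr P; rewrite /L /a; lia.
rewrite mulgA -(mulgA (tperm _ z)) [tperm (P (a + 1)) _]tpermC tperm2 mulg1.
move/cycle3_related => R; apply: (finish z_in); apply: related_sym; apply: R.
rewrite uniq3 ![P 0 == _]eq_sym !l3_neq //=.
rewrite /z; case: l3 s3 l3_uniq => [//|y [//|y' l]] _ /= /andP[yn _].
by apply: contraNneq yn => ->; apply: mem_last.
Qed.

(** Here [L] is [2 * a + 2], and [z] is both ends of [l3]. After a shift by [a + 2] both double
    transpositions contain the pair [P 0], [z]; it cancels, leaving a 3-cycle on [P a], [P (a + 1)],
    [P (a + 2)]. *)
Lemma theta_related_succ : size l3 = 1%N -> size l2 = (size l1).+1 ->
  all_related G u (w :: l1 ++ l2 ++ l3).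
Proof.
move=> s3 s2; have := hole_walkM (double1 0) (double2 (a + 2)); rewrite !addn0.
have -> : last u l3 = z by rewrite /z; case: l3 s3 => [//|y [|//]].
have -> : P (L - 1 + (a + 2)) = P (a + 1) by rewrite -[RHS]P_per; congr P; rewrite /L /a; lia.
have -> : P (a + (a + 2)) = P 0 by rewrite -[RHS]P_per; congr P; rewrite /L /a; lia.
have Pz i : (P i == z) = false by apply/negbTE; rewrite eq_sym l3_neq.
have C1 : commute (tperm (P a) (P (a + 1))) (tperm (P 0) z).
  by apply: tperm_commute; rewrite /= !inE !negb_or !Pz !P_neq /L; lia.
have C2 : commute (tperm (P (a + 2)) (P (a + 1))) (tperm (P 0) z).
  by apply: tperm_commute; rewrite /= !inE !negb_or !Pz !P_neq /L; lia.
rewrite -(C1 : _ * _ = _ * _) (C2 : _ * _ = _ * _) mulgA -(mulgA (tperm (P a) _)).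
rewrite tperm2 mulg1 [tperm (P a) _]tpermC [tperm (P (a + 2)) _]tpermC.
move/cycle3_related => R; apply: (@finish_next a); apply: related_sym.
by rewrite -addn1; apply: R; rewrite uniq3 !P_neq /L; lia.
Qed.
End ThetaLong.

Section ThetaAll.
Variables (T : finType) (G : sgraph T).
Implicit Types (u w x y z t : T) (l p : seq T).

Lemma all_related12 u w l1 l2 l3 : all_related G u (w :: l1 ++ l2 ++ l3) ->
  all_related G u (w :: l2 ++ l1 ++ l3).
Proof.
apply: all_related_sub => t; rewrite !(inE, mem_cat).
by case/or4P=> ->; rewrite ?orbT.
Qed.

Lemma all_related23 u w l1 l2 l3 : all_related G u (w :: l1 ++ l2 ++ l3) ->
  all_related G u (w :: l1 ++ l3 ++ l2).
Proof.
apply: all_related_sub => t; rewrite !(inE, mem_cat).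
by case/or4P=> ->; rewrite ?orbT.
Qed.

(** Once an edge and two equal shortest paths are dealt with, [l2] has at least two inner vertices.
    If [l2] and [l3] have at least seven together, a shift by 2, 4 or 5 is admissible; otherwise
    their sizes are 3 and 3, 2 and 4, or 2 and 3. *)
Lemma theta_related_sorted u w l1 l2 l3 : theta G u w l1 l2 l3 ->
  size l1 <= size l2 <= size l3 -> (size l1, size l2, size l3) != (1, 2, 2) ->
  all_related G u (w :: l1 ++ l2 ++ l3).
Proof.
move=> th /andP[s12 s23] sn.
have [s1|s1] := posnP (size l1).
  move/eqP: s1; rewrite size_eq0 => /eqP l10; subst l1.
  by have := theta_related_0 (theta12 th).
have s2 := leq_trans s1 s12; have s3 := leq_trans s2 s23.
have th132 := theta23 th; have th231 := theta23 (theta12 th).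
have far e : [&& 2 <= e, e <= size l2 + size l3 - 1, e != size l2,
    e != size l2 + 1, e != size l3 & e != size l3 + 1] ->
    all_related G u (w :: l1 ++ l2 ++ l3).
  case/and5P=> e1 e2 e3 e4 /andP[e5 e6].
  by have := theta_related_far th231 s2 s3 s1 e1 e2 e3 e4 e5 e6;
    move/all_related23/all_related12.
have far' e : [&& 2 <= e, e <= size l1 + size l3 - 1, e != size l1,
    e != size l1 + 1, e != size l3 & e != size l3 + 1] ->
    all_related G u (w :: l1 ++ l2 ++ l3).
  case/and5P=> e1 e2 e3 e4 /andP[e5 e6].
  by have := theta_related_far th132 s1 s3 s2 e1 e2 e3 e4 e5 e6;
    move/all_related23.
have [e12|n12] := eqVneq (size l1) (size l2).
  have [s31|s31] := ltnP 1 (size l3); first exact: theta_related_eq.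
  by apply: theta_related_11 => //; lia.
have [big|small] := leqP 7 (size l2 + size l3).
  (* A shift by 2 fails only when [size l2] is 2, and then [size l3] is at least 5. *)
  have [c|c] := boolP ([|| 2 == size l2, 2 == size l2 + 1, 2 == size l3 | 2 == size l3 + 1]);
    last by apply: (far 2); lia.
  have [c3|c3] := boolP (5 <= size l2 + size l3 - 4).
    by apply: (far 5); lia.
  by apply: (far 4); lia.
have [e3|n3] := eqVneq (size l2) 3; first by apply: (far 2); lia.
have e2 : size l2 = 2 by lia.
have e1 : size l1 = 1 by lia.
have [e4|n4] := eqVneq (size l3) 4; first by apply: (far' 3); lia.
have e3 : size l3 = 3.
  by move: sn; rewrite e1 e2 !xpair_eqE; lia.
have := theta_related_succ th231 s2 s3 s1 e1; rewrite e2 e3 => /(_ (erefl _)).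
by move/all_related23/all_related12.
Qed.

Lemma theta_all_related u w l1 l2 l3 : theta G u w l1 l2 l3 ->
  ~~ perm_eq [:: size l1; size l2; size l3] [:: 1; 2; 2] ->
  all_related G u (w :: l1 ++ l2 ++ l3).
Proof.
move=> th np.
have sortedE k1 k2 k3 : theta G u w k1 k2 k3 ->
    perm_eq [:: size k1; size k2; size k3] [:: size l1; size l2; size l3] ->
    size k1 <= size k2 <= size k3 -> all_related G u (w :: k1 ++ k2 ++ k3).
  move=> thk pk sk; apply: theta_related_sorted => //.
  by apply: contra np => /eqP[e1 e2 e3]; rewrite perm_sym e1 e2 e3 in pk *.
have pt (a b c : nat) k : (forall P : pred nat, count P [:: a; b; c] = count P k) ->
  perm_eq [:: a; b; c] k by move=> H; apply/seq.permP.
have [s12|s12] := leqP (size l1) (size l2).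
  have [s23|s23] := leqP (size l2) (size l3); first by apply: sortedE; rewrite ?s12.
  have [s13|s13] := leqP (size l1) (size l3).
    apply/all_related23/sortedE; [exact: theta23|apply: pt=> P /=; lia|lia].
  apply/all_related23/all_related12/sortedE;
    [exact: theta12 (theta23 th)|apply: pt=> P /=; lia|lia].
have [s13|s13] := leqP (size l1) (size l3).
  apply/all_related12/sortedE; [exact: theta12|apply: pt=> P /=; lia|lia].
have [s23|s23] := leqP (size l2) (size l3).
  apply/all_related12/all_related23/sortedE;
    [exact: theta23 (theta12 th)|apply: pt=> P /=; lia|lia].
apply/all_related12/all_related23/all_related12/sortedE;
  [exact: theta12 (theta23 (theta12 th))|apply: pt=> P /=; lia|lia].
Qed.
End ThetaAll.

(** * Ears *)

Section Ears.
Variables (T : finType) (G : sgraph T).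
Implicit Types (u v w x y z t : T) (l p : seq T) (S : {set T}) (s : {perm T}).

Definition induced S : rel T := fun x y => [&& adj G x y, x \in S & y \in S].

Definition joined_in S : Prop := {in S &, forall x y, connect (induced S) x y}.

(** The hole and the two tokens lie in [S], but the closed walks realising the relation may use all
    of [G]. *)
Definition good S : Prop := joined_in S /\
  forall v x y, v \in S -> x \in S :\ v -> y \in S :\ v -> related G v x y.

Lemma induced_sym S : symmetric (induced S).
Proof. by move=> x y; rewrite /induced adj_sym andbCA [(y \in S) && _]andbC andbCA. Qed.

Lemma induced_walk S v v' : connect (induced S) v v' -> exists s,
  [/\ hole_walk G v v' s, {in S, forall x, s x \in S} & forall x, x \notin S -> s x = x].
Proof.
case/connectP=> p; elim: p v => [|v1 p IHp] v /=.
  by move=> _ ->; exists 1%g; split=> [|x|x]; rewrite ?hole_walk1 ?perm1.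
case/andP=> /and3P[vv1 vS v1S] pth e; have [s [W sS sO]] := IHp _ pth e.
exists (tperm v v1 * s)%g; split=> [|x xS|x xS].
- by apply: hole_walkM W; apply: hole_walk_adj.
- by rewrite permM sS //; case: tpermP.
- by rewrite permM tpermD ?sO //; apply: contraNneq xS => <-.
Qed.

(** Walks inside [S] permute [S], so they transport the relation from one position of the hole to
    every other. *)
Lemma good_of_hole S u : u \in S -> joined_in S ->
  (forall x y, x \in S :\ u -> y \in S :\ u -> related G u x y) -> good S.
Proof.
move=> uS cS R; split=> // v x y vS.
have [s [W sS sO]] := induced_walk (cS _ _ vS uS).
have mv t : t \in S :\ v -> s t \in S :\ u.
  rewrite !inE => /andP[tv tS]; rewrite sS // andbT.
  by rewrite -(hole_walk_end W) (inj_eq perm_inj).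
move=> /mv xS /mv yS; rewrite -(permK s x) -(permK s y).
by apply: related_walk (hole_walkV W) _; apply: R.
Qed.

Lemma connect_path_in S u l x : path G u l -> {in u :: l, forall y, y \in S} ->
  x \in u :: l -> connect (induced S) u x.
Proof.
elim: l u => [|v l IHl] u /=; first by move=> _ _; rewrite inE => /eqP->.
case/andP=> uv vl H; rewrite inE => /orP[/eqP->//|xl].
have H' : {in v :: l, forall y, y \in S}.
  by move=> y yl; apply: H; rewrite inE yl orbT.
apply: connect_trans (IHl _ vl H' xl); apply: connect1.
by rewrite /induced uv !H ?inE ?eqxx ?orbT.
Qed.

Lemma connect_induced_sub S S' x y : S \subset S' ->
  connect (induced S) x y -> connect (induced S') x y.
Proof.
move/subsetP=> sub; apply: connect_sub => a b /and3P[ab aS bS].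
by apply: connect1; rewrite /induced ab !sub.
Qed.

Lemma joined_in_root S u : {in S, forall x, connect (induced S) u x} -> joined_in S.
Proof.
move=> H x y xS yS; apply: connect_trans (H _ yS).
by rewrite (sym_connect_sym (@induced_sym S)); apply: H.
Qed.

(* Sending the hole once around the ear and back inside [S] shifts the tokens
   of the ear by one place, so they enter the class of [S] one after another. *)
Lemma good_ear S u w l : good S -> 2 < #|S| -> u \in S -> w \in S -> u != w ->
  path G u (rcons l w) -> uniq l -> {in l, forall x, x \notin S} ->
  good (S :|: [set x in l]).
Proof.
move=> [cS RS] S3 uS wS uw pth Ul lS; set S' := S :|: _.
have uS' : u \in S' by rewrite inE uS.
have sub : S \subset S' by apply: subsetUl.
apply: (good_of_hole uS').
  apply: (@joined_in_root _ u) => x; rewrite 2!inE => /orP[xS|xl].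
    by apply: (connect_induced_sub sub); apply: cS.
  apply: (connect_path_in pth); last by rewrite inE mem_rcons inE xl !orbT.
  move=> y; rewrite !(inE, mem_rcons) => /or3P[/eqP->|/eqP->|->]; rewrite ?uS ?wS //.
  by rewrite orbT.
have [t [Wt tS tO]] := induced_walk (cS _ _ wS uS).
have Wl := path_perm_walk pth; rewrite last_rcons in Wl.
set g := path_perm u (rcons l w) in Wl.
have Wg := hole_walkM Wl Wt.
have Ulw : uniq (u :: rcons l w).
  rewrite /= mem_rcons inE negb_or uw rcons_uniq Ul andbT /=.
  by apply/andP; split; [apply: contraL uS|apply: contraL wS]; apply: lS.
(* A third vertex of [S]: its token is untouched by the ear and represents the class of [S]. *)
have [x0 x0S] : exists x0, x0 \in S :\ u :\ w.
  apply/set0Pn; rewrite -card_gt0; have := cardsD1 u S; have := cardsD1 w (S :\ u).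
  by rewrite uS !inE wS eq_sym uw /=; move: S3; clear; lia.
move: (x0S); rewrite !inE => /and3P[x0w x0u x0in].
have gS x : x \in S -> x != u -> x != w -> g x = x.
  move=> xS xu xw; apply: path_perm_out.
  by rewrite inE mem_rcons inE !negb_or xu xw /=; apply: contraL xS; apply: lS.
have tSu x : x \in S -> x != w -> t x \in S :\ u.
  move=> xS xw; rewrite !inE tS // andbT.
  by rewrite -(hole_walk_end Wt) (inj_eq perm_inj).
(* Induction from the end of the ear at [w]: [k = 0] is the last inner vertex, reached by the token
   at [w]. *)
have main k x : k < size l -> x \in S :\ u -> related G u x (nth u l (size l - k.+1)).
  elim: k x => [|k IHk] x kl xS; set y := nth _ _ _.
    have R := RS u x0 w uS _ _; have/R{}R : x0 \in S :\ u by rewrite !inE x0u.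
    have/R{}R : w \in S :\ u by rewrite !inE eq_sym uw.
    have := related_walk Wg R; rewrite !permM gS //.
    have -> : g w = last u l.
      by rewrite /g -cats1 path_perm_in // cats1.
    have ye : last u l = y by rewrite /y subn1 nth_last; case: (l) kl.
    have yl : y \in l by rewrite mem_nth // subnSK // leq_subr.
    rewrite ye (tO y) ?lS //; apply: related_trans.
    by apply: RS => //; apply: tSu.
  have yl : y \in l by rewrite mem_nth // subnSK // leq_subr.
  have x0u' : x0 \in S :\ u by rewrite !inE x0u.
  have := related_walk Wg (IHk x0 (ltnW kl) x0u'); rewrite !permM gS //.
  set y' := nth _ _ _; have -> : g y' = y.
    have il : size l - k.+1 < size l by rewrite subnSK ?leq_subr // ltnW.
    have e : rcons l w = take (size l - k.+1) l ++ y' :: rcons (drop (size l - k.+1).+1 l) w.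
      by rewrite -rcons_cons -drop_nth // -rcons_cat cat_take_drop.
    rewrite /g e path_perm_in -?e // (last_nth u) /=.
    have -> : size (take (size l - k.+1) l) = (size l - k.+2).+1.
      by rewrite size_takel ?leq_subr // subnSK.
    by rewrite /= nth_take // subnSK.
  rewrite (tO y) ?lS //; apply: related_trans.
  by apply: RS => //; apply: tSu.
have inl x : x \in l -> related G u x0 x.
  move=> xl; have xi : index x l < size l by rewrite index_mem.
  have -> : x = nth u l (size l - (size l - (index x l).+1).+1).
    by rewrite -{1}(nth_index u xl); congr nth; move: xi; clear; lia.
  by apply: main; [move: xi; clear; lia|rewrite !inE x0u].
have all x : x \in S' :\ u -> related G u x0 x.
  rewrite !inE => /andP[xu /orP[xS|]]; last exact: inl.
  by apply: RS; rewrite // !inE ?x0u ?xu.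
by move=> x y xS yS; apply: related_trans (all y yS); apply: related_sym (all x xS).
Qed.

Lemma connect_exit (e : rel T) S x y : connect e x y -> x \in S -> y \notin S ->
  exists a b, [/\ e a b, a \in S & b \notin S].
Proof.
case/connectP=> p; elim: p x => [|z p IHp] x /=.
  by move=> _ -> ->.
case/andP=> xz zp e_y xS yS.
have [zS|zS] := boolP (z \in S); first exact: IHp zp e_y zS yS.
by exists x, z.
Qed.

(** Cut the path at its first vertex in [S], then remove repetitions; shortening adds no vertices,
    so all but the last still avoid [S]. *)
Lemma path_first_hit (e : rel T) S x p : path e x p -> x \notin S -> last x p \in S ->
  exists l w, [/\ path e x (rcons l w), uniq (x :: rcons l w), w \in S &
    {in x :: l, forall y, y \notin S}].
Proof.
move=> xp xS lS.
have [l [w [pl wS lo]]] : exists l w, [/\ path e x (rcons l w), w \in S &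
    {in x :: l, forall y, y \notin S}].
  elim: p x xp xS lS => [|y p IHp] x /=; first by move=> _ /negbTE ->.
  case/andP=> xy yp xS lS; have [yS|yS] := boolP (y \in S).
    by exists [::], y; split=> //=; [rewrite xy|move=> t; rewrite inE => /eqP->].
  have [l [w [pl wS lo]]] := IHp _ yp yS lS.
  exists (y :: l), w; split=> //=; first by rewrite xy.
  by move=> t; rewrite inE => /orP[/eqP->//|]; apply: lo.
move: {xp lS}(pl); case/shortenP: pl (last_rcons x l w) => p' xp' Up' subp lw _.
have lo' y : y \in x :: p' -> y != w -> y \notin S.
  rewrite inE => /orP[/eqP->//|/subp]; rewrite mem_rcons inE => /orP[->//|yl _].
  by apply: lo; rewrite inE yl orbT.
case/lastP: p' xp' Up' subp lw lo' => [|l' w'] xp' Up' subp.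
  by move=> /= xw; rewrite xw wS in xS.
rewrite last_rcons => e1; subst w' => lo'.
exists l', w; split=> // y yl.
move: Up'; rewrite -rcons_cons rcons_uniq => /andP[wn _].
apply: lo'; last by apply: contraNneq wn => <-.
by rewrite -rcons_cons mem_rcons inE yl orbT.
Qed.

Hypothesis G_joined : forall x y, connect G x y.
Hypothesis G_nocut : forall v, joined_in [set~ v].

(** Some edge from [u] to [q] leaves [S]. As [u] is no cut vertex, [q] reaches another vertex of [S]
    without [u]; the first return to [S] ends the ear, which has [q] as an inner vertex. *)
Lemma ear_exists S (s1 s2 x : T) : s1 \in S -> s2 \in S -> s1 != s2 -> x \notin S ->
  exists u w l, [/\ [/\ u \in S, w \in S & u != w], path G u (rcons l w), uniq l,
    {in l, forall y, y \notin S} & l != [::]].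
Proof.
move=> s1S s2S s12 xS.
have [u [q [uq uS qS]]] := connect_exit (G_joined s1 x) s1S xS.
have [w0 w0S w0u] : exists2 w0, w0 \in S & w0 != u.
  by have [e|n] := eqVneq s1 u; [exists s2; rewrite // -e eq_sym|exists s1].
have qu : q != u by apply: contraNneq qS => ->.
have: connect (induced [set~ u]) q w0 by apply: G_nocut; rewrite !inE.
case/connectP=> p qp e; rewrite e in w0S.
have [l [w [pl Ul wS lo]]] := path_first_hit qp qS w0S.
exists u, w, (q :: l); split=> //.
- split=> //; have: path (induced [set~ u]) q (rcons l w) by [].
  by rewrite rcons_path => /andP[_ /and3P[_ _]]; rewrite !inE eq_sym.
- rewrite /= uq; apply: sub_path pl => a b; by case/and3P.
- by move: Ul; rewrite -rcons_cons rcons_uniq => /andP[].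
Qed.

(** Every ear has an inner vertex, so adding ears shrinks the complement of [S]. *)
Lemma good_setT S : good S -> 2 < #|S| -> good setT.
Proof.
move: {2}#|~: S| (leqnn #|~: S|) => n; elim: n S => [|n IHn] S Sn gS S3.
  by move: Sn; rewrite leqn0 cards_eq0 -subset0 -setCT setCS subTset => /eqP <-.
have [e|ne] := eqVneq S setT; first by rewrite -e.
have [x xS] : exists x, x \notin S.
  by apply/existsP; rewrite -negb_forall; apply: contra ne => /forallP H;
     apply/eqP/setP=> y; rewrite H inE.
have [s1 [s2 [s1S s2S s12]]] : exists s1 s2 : T, [/\ s1 \in S, s2 \in S & s1 != s2].
  by have /card_gt1P[s1 [s2 [? ? ?]]] := ltnW S3; exists s1, s2.
have [u [w [l [[uS wS uw] pl Ul lS ln]]]] := ear_exists s1S s2S s12 xS.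
apply: IHn (good_ear gS S3 uS wS uw pl Ul lS) _; last first.
  by apply: leq_trans S3 _; apply: subset_leq_card; apply: subsetUl.
rewrite -ltnS; apply: leq_trans Sn; apply: proper_card; rewrite properC.
case: l ln lS {pl Ul} => // y l _ lS; apply/properP; split; first exact: subsetUl.
by exists y; rewrite ?inE ?eqxx ?orbT // lS // mem_head.
Qed.
End Ears.

(** * Finding a theta graph *)

Definition theta0_edge (i j : nat) : bool :=
  let E := [:: (0, 1); (1, 2); (2, 3); (3, 4); (4, 5); (5, 0); (6, 0); (6, 3)] in
  ((i, j) \in E) || ((j, i) \in E).

(* An entry [(u, w, l1, l2, pre, post)] stands for the three paths [l1], [l2]
   and [pre ++ ear ++ post] from [u] to [w] in [theta0] with an additional ear
   from the end of [u :: pre] to the head of [rcons post w]. *)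
Definition ear_theta : Type := nat * nat * seq nat * seq nat * seq nat * seq nat.

(** One entry for each pair of ends [s < t], in lexicographic order, except the branch vertices [0]
    and [3], which are treated separately. *)
Definition ear_thetas : seq ear_theta :=
  [:: (0, 1, [::], [:: 6; 3; 2], [::], [::]);
   (0, 2, [:: 1], [:: 5; 4; 3], [::], [::]);
   (0, 4, [:: 1; 2; 3], [:: 5], [::], [::]);
   (0, 5, [::], [:: 6; 3; 4], [::], [::]);
   (0, 6, [::], [:: 1; 2; 3], [::], [::]);
   (1, 2, [::], [:: 0; 6; 3], [::], [::]);
   (1, 3, [:: 0; 5; 4], [:: 2], [::], [::]);
   (1, 0, [::], [:: 2; 3; 6], [::], [:: 4; 5]);
   (0, 5, [::], [:: 6; 3; 4], [:: 1], [::]);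
   (0, 6, [::], [:: 5; 4; 3], [:: 1], [::]);
   (2, 3, [::], [:: 1; 0; 6], [::], [::]);
   (2, 3, [::], [:: 1; 0; 6], [::], [:: 4]);
   (0, 5, [::], [:: 6; 3; 4], [:: 1; 2], [::]);
   (3, 6, [::], [:: 4; 5; 0], [:: 2], [::]);
   (3, 4, [::], [:: 6; 0; 5], [::], [::]);
   (3, 5, [:: 2; 1; 0], [:: 4], [::], [::]);
   (3, 6, [::], [:: 2; 1; 0], [::], [::]);
   (4, 5, [::], [:: 3; 6; 0], [::], [::]);
   (3, 6, [::], [:: 2; 1; 0], [:: 4], [::]);
   (0, 6, [::], [:: 1; 2; 3], [:: 5], [::])].

Definition ear_theta_ok (s t : nat) (d : ear_theta) : bool :=
  let: (u, w, l1, l2, pre, post) := d in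
  [&& uniq (u :: w :: l1 ++ l2 ++ pre ++ post),
      all (gtn 7) (u :: w :: l1 ++ l2 ++ pre ++ post),
      path theta0_edge u (rcons l1 w), path theta0_edge u (rcons l2 w),
      path theta0_edge u pre, last u pre == s, head w post == t &
      path theta0_edge t (behead (rcons post w))].

(** The ear has unknown length, so the first two sizes alone must exclude 1, 2, 2. The middle
    condition prevents a second bare edge; it counts on inner vertices of the ear only if [s] and
    [t] are already adjacent. *)
Definition ear_sizes_ok (s t : nat) (d : ear_theta) : bool :=
  let: (u, w, l1, l2, pre, post) := d in
  [&& 0 < size l1 + size l2,
      (0 < minn (size l1) (size l2) + size pre + size post) || theta0_edge s t &
      (size l1, size l2) \notin [:: (1, 2); (2, 1); (2, 2)]].

Lemma ear_thetas_ok s t : s < t -> t < 7 -> (s, t) != (0, 3) ->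
  exists2 d, ear_theta_ok s t d & ear_sizes_ok s t d.
Proof.
have /allP H : all (fun s => all (fun t => [|| ~~ (s < t), (s, t) == (0, 3) |
    has (predI (ear_theta_ok s t) (ear_sizes_ok s t)) ear_thetas]) (iota 0 7)) (iota 0 7).
  by vm_compute.
move=> st t7 n03; have s7 := ltn_trans st t7.
have/H/allP H' : s \in iota 0 7 by rewrite mem_iota.
have/H' : t \in iota 0 7 by rewrite mem_iota.
by rewrite st (negbTE n03) => /hasP[d _ /andP[]]; exists d.
Qed.

Section FindTheta.
Variables (T : finType) (G : sgraph T).
Implicit Types (u v w x y z t : T) (l p : seq T) (S : {set T}).

Definition good_theta : Prop := exists u w l1 l2 l3, theta G u w l1 l2 l3 /\
  ~~ perm_eq [:: size l1; size l2; size l3] [:: 1; 2; 2].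

Lemma good_theta_good : good_theta -> exists2 S, good G S & 2 < #|S|.
Proof.
move=> [u [w [l1 [l2 [l3 [th np]]]]]]; have R := theta_all_related th np.
case/and5P: th => U P1 P2 P3 /and3P[s12 s13 s23].
exists [set x in u :: w :: l1 ++ l2 ++ l3]; last first.
  by rewrite cardsE (card_uniqP U) /= !size_cat; lia.
apply: (@good_of_hole _ _ _ u); first by rewrite inE mem_head.
  apply: (@joined_in_root _ _ _ u) => x.
  have H l : {subset l <= l1 ++ l2 ++ l3} -> path G u (rcons l w) ->
      x \in u :: rcons l w ->
      connect (induced G [set x in u :: w :: l1 ++ l2 ++ l3]) u x.
    move=> sub pl; apply: connect_path_in pl _ => y.
    rewrite !(inE, mem_rcons) => /or3P[->|->|/sub]; rewrite ?orbT //.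
    by rewrite !mem_cat => ->; rewrite !orbT.
  rewrite !inE !mem_cat => /orP[/eqP->|/or4P[/eqP->|x1|x2|x3]].
  - exact: connect0.
  - apply: (connect_path_in P1); last by rewrite inE mem_rcons mem_head orbT.
    move=> y; rewrite !(inE, mem_rcons, mem_cat).
    by case/or3P=> ->; rewrite ?orbT.
  - by apply: H P1 _; [move=> y; rewrite !mem_cat => ->|rewrite inE mem_rcons inE x1 !orbT].
  - by apply: H P2 _; [move=> y; rewrite !mem_cat => ->|rewrite inE mem_rcons inE x2 !orbT];
      rewrite ?orbT.
  - by apply: H P3 _; [move=> y; rewrite !mem_cat => ->|rewrite inE mem_rcons inE x3 !orbT];
      rewrite ?orbT.
move=> x y; rewrite !in_setD1 !inE => /andP[xu xS] /andP[yu yS].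
by apply: R; [move: xS|move: yS]; rewrite inE (negbTE xu, negbTE yu).
Qed.

(** The ear may be a chord, with [l] empty; the last hypothesis then gives both arcs of the cycle an
    inner vertex. *)
Lemma cycle_ear_theta C s t l : uniq C -> path.cycle G C -> 2 < size C ->
  s \in C -> t \in C -> s != t -> path G s (rcons l t) -> uniq l ->
  {in l, forall y, y \notin C} -> (l != [::]) || ((next C s != t) && (next C t != s)) ->
  exists l1 l2, theta G s t l1 l2 l.
Proof.
move=> UC cC C3 sC tC st pl Ul lC.
have [i C' e] := rot_to sC.
have tC' : t \in C' by move: tC; rewrite -(mem_rot i) e inE eq_sym (negbTE st).
rewrite -!(next_rot i UC) e.
move: (UC) (cC) (C3); rewrite -(rot_uniq i) -(rot_cycle i) -(size_rot i) e.
have lC' y : y \in l -> y \notin s :: C' by rewrite -e mem_rot; apply: lC.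
case/splitPr: tC' lC' => l1 l2 lC' U cy sz nl.
exists l1, (rev l2); rewrite /theta; apply/and5P; split => //.
- rewrite (perm_uniq (_ : perm_eq _ ((s :: l1 ++ t :: l2) ++ l))).
    rewrite cat_uniq U Ul andbT /=; apply/hasPn => y yl; exact: lC'.
  by apply/seq.permP => P; rewrite /= !count_cat /= count_rev ?count_cat; clear; lia.
- by move: cy; rewrite /= rcons_cat -cat_rcons cat_path => /andP[].
- rewrite path_rcons_rev revK.
  by move: cy; rewrite /= rcons_cat rcons_cons -cat_rcons cat_path last_rcons => /andP[].
have s12 : 0 < size l1 + size l2 by move: sz; rewrite /= size_cat /=; clear; lia.
rewrite !size_rev s12 /=.
case: l nl {pl Ul lC lC'} => [|y l] /=; last by rewrite !addnS.
case/andP=> n1 n2; rewrite !addn0 !lt0n !size_eq0; apply/andP; split.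
  apply: contraNneq n1 => l10; rewrite l10 /= in U *.
  by apply/eqP; exact: (next_cat (l1 := [::]) U).
apply: contraNneq n2 => l20; rewrite l20 cats1 in U *.
by apply/eqP; have := next_last U; rewrite last_rcons; exact.
Qed.

Hypothesis G_joined : forall x y, connect G x y.
Hypothesis G_nocut : forall v, joined_in G [set~ v].

(** The two ends of an edge have an ear, which the edge closes to a cycle. *)
Lemma cycle_exists : 2 < #|T| -> exists C, [/\ uniq C, path.cycle G C & 2 < size C].
Proof.
rewrite -cardsT => T3; have /card_gt1P[x [y [_ _ xy]]] := ltnW T3.
have [|//|a [b [ab]]] := @connect_exit _ G [set x] _ _ (G_joined x y).
- by rewrite inE.
- by rewrite inE eq_sym.
rewrite !inE => /eqP ax bx; subst a.
have [z zS] : exists z, z \notin [set x; b].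
  apply/existsP; rewrite -negb_forall; apply: contraL T3 => /forallP H.
  have -> : [set: T] = [set x; b] by apply/setP=> t; rewrite H inE.
  by rewrite -leqNgt cards2; case: (_ != _).
have xS : x \in [set x; b] by rewrite !inE eqxx.
have bS : b \in [set x; b] by rewrite !inE eqxx orbT.
rewrite eq_sym in bx.
have [u [w [l [[uS wS uw] pl Ul lS ln]]]] := ear_exists G_joined G_nocut xS bS bx zS.
have wu : adj G w u.
  move: uS wS uw; rewrite !inE => /orP[]/eqP-> /orP[]/eqP->; rewrite ?eqxx //.
  by rewrite adj_sym.
exists (u :: rcons l w); split.
- rewrite /= mem_rcons inE negb_or uw rcons_uniq Ul andbT /=.
  by apply/andP; split; [apply: contraL uS|apply: contraL wS]; apply: lS.
- by rewrite /= rcons_path pl last_rcons.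
- by rewrite /= size_rcons; case: l ln {pl Ul lS}.
Qed.

Lemma hamiltonian_iso C : uniq C -> path.cycle G C -> (forall x, x \in C) ->
  (forall x y, adj G x y -> (next C x == y) || (next C y == x)) ->
  graph_iso G (cycle_graph (size C)).
Proof.
move=> UC cC inC adjC.
have ltC x : index x C < size C by rewrite index_mem.
have f_inj : injective (fun x => Ordinal (ltC x)).
  by move=> x y [] /(congr1 (nth x C)); rewrite !nth_index.
have nextE x y : (index y C == (index x C).+1 %% size C) = (next C x == y).
  have e := next_nthS x UC (ltC x); rewrite nth_index // in e.
  apply/eqP/eqP => [E|<-]; first by rewrite e -E nth_index.
  by rewrite e index_uniq // ltn_mod (leq_ltn_trans _ (ltC x)).
exists (fun x => Ordinal (ltC x)).
  exists (fun i : 'I_(size C) => tnth (in_tuple C) i) => [x|i].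
    by rewrite (tnth_nth x) /= nth_index.
  by apply: val_inj; rewrite /= (tnth_nth (tnth (in_tuple C) i)) index_uniq.
move=> x y; rewrite /= /sym_rel /= !nextE (inj_eq f_inj).
apply/idP/idP => [/andP[xy /orP[]/eqP <-]|xy].
- exact: next_cycle.
- by rewrite adj_sym; apply: next_cycle.
rewrite adjC // andbT; apply: contraTneq xy => ->; by rewrite adj_irrefl.
Qed.

(** A cycle missing a vertex has an ear, a spanning cycle with a chord is a theta, and a spanning
    cycle without chords is the whole graph. *)
Lemma theta_exists : 3 < #|T| ->
  ~ (exists2 k, 4 <= k & graph_iso G (cycle_graph k)) ->
  exists u w l1 l2 l3, theta G u w l1 l2 l3.
Proof.
move=> T4 nc; have [C [UC cC C3]] := cycle_exists (ltnW T4).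
have [s1 [s2 [s1C s2C s12]]] : exists s1 s2, [/\ s1 \in C, s2 \in C & s1 != s2].
  case: C UC C3 {cC} => [//|a [//|b C]] /= /andP[an _] _; exists a, b.
  by rewrite !inE !eqxx orbT; split=> //; apply: contraNneq an => ->; rewrite mem_head.
have [/forallP inC|] := boolP [forall x, x \in C]; last first.
  rewrite negb_forall => /existsP[x xC].
  have s1S : s1 \in [set x in C] by rewrite inE.
  have s2S : s2 \in [set x in C] by rewrite inE.
  have xS : x \notin [set x in C] by rewrite inE.
  have [u [w [l [[uS wS uw] pl Ul lS ln]]]] := ear_exists G_joined G_nocut s1S s2S s12 xS.
  rewrite !inE in uS wS.
  have [||l1 [l2 th]] := cycle_ear_theta UC cC C3 uS wS uw pl Ul.
  - by move=> y /lS; rewrite inE.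
  - by rewrite ln.
  by exists u, w, l1, l2, l.
have [/existsP[x /existsP[y /and3P[xy nx ny]]]|nochord] :=
    boolP [exists x, exists y, [&& adj G x y, next C x != y & next C y != x]].
  have xny : x != y by apply: contraTneq xy => ->; rewrite adj_irrefl.
  have [||||l1 [l2 th]] := @cycle_ear_theta C x y [::] UC cC C3 (inC x) (inC y) xny;
    rewrite //= ?xy ?nx ?ny //.
  by exists x, y, l1, l2, [::].
case: nc; exists (size C).
  by apply: leq_trans T4 _; rewrite -(card_uniqP UC); apply: subset_leq_card; apply/subsetP.
apply: hamiltonian_iso => // x y xy; move: nochord; rewrite negb_exists.
move/forallP/(_ x); rewrite negb_exists => /forallP/(_ y).
by rewrite xy /= negb_and !negbK.
Qed.

(** * Ears on a copy of [theta0] *)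

Section Theta0.
Variables (u w x y1 y2 z1 z2 : T).
Hypothesis th : theta G u w [:: x] [:: y1; y2] [:: z1; z2].

(** Listed so that the position of a vertex is its number in [theta0]: the branch vertices [u] and
    [w] are 0 and 3. *)
Let vs := [:: u; y1; y2; w; z2; z1; x].
Let c i := nth u vs i.

Let vs_uniq : uniq vs.
Proof.
case/andP: th => U _; move: U; rewrite (perm_uniq (_ : perm_eq _ vs)) //.
by apply/seq.permP => P /=; lia.
Qed.

Let c_edge i j : theta0_edge i j -> adj G (c i) (c j).
Proof.
case/and5P: th => _ /= /and3P[e1 e2 _] /and4P[e3 e4 e5 _] /and4P[e6 e7 e8 _] _.
by rewrite /theta0_edge !inE !xpair_eqE -!orbA;
  do 15?[case/orP]; case/andP=> /eqP-> /eqP->; rewrite /c //= adj_sym.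
Qed.

Lemma theta0_ear_lt (s t : nat) l : s < t -> t < 7 -> path G (c s) (rcons l (c t)) -> uniq l ->
  {in l, forall y, y \notin vs} -> (l != [::]) || ~~ theta0_edge s t -> good_theta.
Proof.
move=> st t7 pl Ul lS ln.
have [[e1 e2]|n03] := eqVneq (s, t) (0, 3).
  subst s t; rewrite /c /= in pl.
  have U : uniq (u :: w :: [:: x] ++ [:: y1; y2] ++ [:: z1; z2] ++ l).
    rewrite (perm_uniq (_ : perm_eq _ (vs ++ l))) ?cat_uniq ?vs_uniq ?Ul ?andbT.
      by apply/hasPn => y yl; apply: lS.
    by apply/seq.permP => P; rewrite /= ?count_cat; clear; lia.
  case/and5P: th => _ P1 P2 P3 _.
  (* Four paths now join [u] and [w]. If the new one has two inner vertices, the sizes 2, 2, 2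
     serve; otherwise 1, 2 and its own size. *)
  have [k2|k2] := eqVneq (size l) 2.
    exists u, w, [:: y1; y2], [:: z1; z2], l; split; last by rewrite k2.
    rewrite /theta P2 P3 pl !andbT; apply: subseq_uniq U.
    apply: (@cat_subseq _ [:: u; w] _ [:: u; w]) => //; exact: subseq_cons.
  exists u, w, [:: x], [:: y1; y2], l; split.
    rewrite /theta P1 P2 pl !andbT; apply: subseq_uniq U.
    by apply: (@cat_subseq _ [:: u; w; x; y1; y2] _ [:: u; w; x; y1; y2]) => //;
      apply: suffix_subseq.
  by apply/negP => /seq.permP/(_ (pred1 2)) /=; rewrite (negbTE k2); clear; lia.
have [[[[[[bu bw] m1] m2] pre] post]] := ear_thetas_ok st t7 n03.
move=> /and5P[Um am Pm1 Pm2 /and4P[Ppre /eqP lpre /eqP hpost Ppost]] /and3P[z12 zm nz].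
have cpath i m : path theta0_edge i m -> path G (c i) (map c m).
  by apply: homo_path => a b; apply: c_edge.
exists (c bu), (c bw), (map c m1), (map c m2), (map c pre ++ l ++ map c post); split.
  rewrite /theta -!map_rcons !cpath // !size_map z12 !size_cat !size_map.
  apply/and5P; split=> //; last first.
  - by move: zm ln z12; rewrite -size_eq0; clear; case: theta0_edge => /=; lia.
  - rewrite rcons_cat cat_path cpath //= last_map lpre rcons_cat -map_rcons.
    have -> : rcons post bw = t :: behead (rcons post bw).
      by move: hpost; case: (post) => [|? ?] /= ->.
    by rewrite /= -cat_rcons cat_path pl last_rcons cpath.
  rewrite (perm_uniq (_ : perm_eq _ (map c (bu :: bw :: m1 ++ m2 ++ pre ++ post) ++ l))).
    rewrite cat_uniq Ul andbT; apply/andP; split.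
      rewrite map_inj_in_uniq // => i j; move/allP: am => am /am i7 /am j7 /eqP.
      by rewrite nth_uniq // => /eqP.
    apply/hasPn => y /lS; apply: contra => /mapP[i]; move/allP: am => am /am i7 ->.
    exact: mem_nth.
  by apply/seq.permP => P; rewrite /= !map_cat !count_cat; clear; lia.
rewrite !size_map; apply: contra nz => pm.
have m1in : size m1 \in [:: 1; 2; 2] by rewrite -(perm_mem pm) mem_head.
have m2in : size m2 \in [:: 1; 2; 2] by rewrite -(perm_mem pm) !inE eqxx orbT.
move/seq.permP/(_ (pred1 1)): pm m1in m2in; rewrite !inE !xpair_eqE /=; clear; lia.
Qed.

Lemma theta0_ear (s t : nat) l : s != t -> s < 7 -> t < 7 -> path G (c s) (rcons l (c t)) ->
  uniq l -> {in l, forall y, y \notin vs} -> (l != [::]) || ~~ theta0_edge s t ->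
  good_theta.
Proof.
rewrite neq_ltn => /orP[st|ts] s7 t7 pl Ul lS ln; first exact: theta0_ear_lt pl Ul lS ln.
apply: (@theta0_ear_lt t s (rev l)) => //.
- by rewrite path_rcons_rev revK.
- by rewrite rev_uniq.
- by move=> y; rewrite mem_rev; apply: lS.
- have -> : theta0_edge t s = theta0_edge s t by rewrite /theta0_edge orbC.
  by rewrite -size_eq0 size_rev size_eq0.
Qed.

(** The graph has a vertex outside the copy, hence an ear, or a further edge inside it. *)
Lemma theta0_good_theta : ~ graph_iso G theta0 -> good_theta.
Proof.
move=> niso; have iv v : v \in vs -> index v vs < 7 by rewrite -index_mem.
have ci v : v \in vs -> c (index v vs) = v by apply: nth_index.
have [/forallP inv|] := boolP [forall v, v \in vs]; last first.
  rewrite negb_forall => /existsP[v vS0].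
  have uS : u \in [set v in vs] by rewrite inE mem_head.
  have wS : w \in [set v in vs] by rewrite !inE eqxx !orbT.
  have uw : u != w by case/andP: th => /= /andP[]; rewrite inE negb_or => /andP[].
  have vS : v \notin [set v in vs] by rewrite inE.
  have [s [t [l [[sS tS st] pl Ul lS ln]]]] := ear_exists G_joined G_nocut uS wS uw vS.
  rewrite !in_set in sS tS.
  apply: (@theta0_ear (index s vs) (index t vs) l) => //.
  - by apply: contraNneq st => e; rewrite -(ci s) // e ci.
  - exact: iv.
  - exact: iv.
  - by rewrite !ci.
  - by move=> y /lS; rewrite in_set.
  - by rewrite ln.
have [/existsP[i /existsP[j /andP[ij nij]]]|noedge] :=
    boolP [exists i : 'I_7, exists j : 'I_7, adj G (c i) (c j) && ~~ theta0_edge i j].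
  apply: (@theta0_ear i j [::]) => //=; last by rewrite ij.
  by apply: contraTneq ij => ->; rewrite adj_irrefl.
case: niso; have lt7 v : index v vs < 7 by apply: iv.
have f_inj : injective (fun v => Ordinal (lt7 v)).
  by move=> a b /(congr1 (fun i : 'I_7 => c i)); rewrite !ci.
exists (fun v => Ordinal (lt7 v)).
  exists (fun i : 'I_7 => c i) => [v|i]; first exact: ci.
  by apply: val_inj; apply: index_uniq.
have th0E (i j : 'I_7) : adj theta0 i j = (i != j) && theta0_edge i j by [].
move=> a b; rewrite th0E (inj_eq f_inj).
apply/andP/idP => [[_ /c_edge]|ab]; first by rewrite !ci.
split; first by apply: contraTneq ab => ->; rewrite adj_irrefl.
move: noedge; rewrite negb_exists => /forallP/(_ (Ordinal (lt7 a))).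
rewrite negb_exists => /forallP/(_ (Ordinal (lt7 b))).
by rewrite !ci // ab negbK.
Qed.
End Theta0.

Lemma good_theta_exists : 3 < #|T| ->
  ~ (exists2 k, 4 <= k & graph_iso G (cycle_graph k)) -> ~ graph_iso G theta0 ->
  good_theta.
Proof.
move=> T4 nc n0; have [u [w [l1 [l2 [l3 th]]]]] := theta_exists T4 nc.
have [pm|np] := boolP (perm_eq [:: size l1; size l2; size l3] [:: 1; 2; 2]); last first.
  by exists u, w, l1, l2, l3.
have std k1 k2 k3 : theta G u w k1 k2 k3 -> size k1 = 1 -> size k2 = 2 -> size k3 = 2 ->
    good_theta.
  case: k1 => [|a [|? ?]] //; case: k2 => [|b1 [|b2 [|? ?]]] //.
  by case: k3 => [|d1 [|d2 [|? ?]]] // th' _ _ _; apply: theta0_good_theta th' n0.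
have m1in : size l1 \in [:: 1; 2; 2] by rewrite -(perm_mem pm) mem_head.
have m2in : size l2 \in [:: 1; 2; 2] by rewrite -(perm_mem pm) !inE eqxx orbT.
have m3in : size l3 \in [:: 1; 2; 2] by rewrite -(perm_mem pm) !inE eqxx !orbT.
move/seq.permP/(_ (pred1 1)): pm m1in m2in m3in; rewrite !inE /= => pm m1 m2 m3.
have [e1|n1] := eqVneq (size l1) 1; first by apply: std th _ _ _; lia.
have [e2|n2] := eqVneq (size l2) 1; first by apply: std (theta12 th) _ _ _; lia.
by apply: std (theta12 (theta23 th)) _ _ _; lia.
Qed.
End FindTheta.

(** * Wilson's theorem *)

Section Wilson.
Variables (T : finType) (G : sgraph T).
Implicit Types (u v w x y z t : T) (s : {perm T}).
Local Open Scope group_scope.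

Lemma connect_hole_walk u v : connect G u v -> exists s, hole_walk G u v s.
Proof.
by case/connectP=> p up ->; exists (path_perm u p); apply: path_perm_walk.
Qed.

Hypothesis G_joined : forall x y, connect G x y.

(** Without odd closed walks the parity of a walk from [v] to [x] depends only on [x], and this is a
    proper 2-colouring. *)
Lemma odd_closed_walk v : ~ bipartite G -> exists2 s, hole_walk G v v s & odd_perm s.
Proof.
move=> nb; have [/existsP[s /andP[]]|/existsPn noodd] :=
    boolP [exists s, hole_walk G v v s && odd_perm s]; first by exists s.
have par x s : hole_walk G v x s ->
    [exists s', hole_walk G v x s' && odd_perm s'] = odd_perm s.
  move=> Ws; apply/existsP/idP => [[s' /andP[Ws' os']]|os]; last by exists s; rewrite Ws.
  have := noodd (s' * s^-1); rewrite (hole_walkM Ws' (hole_walkV Ws)) odd_permM odd_permV.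
  by rewrite os' /= negbK.
case: nb; exists (fun x => [exists s, hole_walk G v x s && odd_perm s]) => x y xy.
have [s Ws] := connect_hole_walk (G_joined v x).
rewrite (par x s Ws) (par y _ (hole_walkM Ws (hole_walk_adj xy))).
have xNy : x != y by apply: contraTneq xy => ->; rewrite adj_irrefl.
rewrite odd_permM odd_tperm xNy.
by rewrite addbT; case: odd_perm.
Qed.

(** * From 3-cycles to all permutations fixing the hole *)

Section Symmetric.
Variable v : T.
Hypothesis alt : forall x y z, uniq [:: x; y; z] -> v \notin [:: x; y; z] ->
  hole_walk G v v (cycle3 x y z).

Lemma walk_tperm2 x y z t : x != y -> z != t -> v \notin [:: x; y; z; t] ->
  hole_walk G v v (tperm x y * tperm z t).
Proof.
move=> xy zt; rewrite !inE !negb_or => /and4P[vx vy vz vt].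
have adjacent a b c : a != b -> a != c -> v != a -> v != b -> v != c ->
    hole_walk G v v (tperm a b * tperm a c).
  move=> ab ac va vb vc; have [->|bc] := eqVneq b c; first by rewrite tperm2 hole_walk1.
  by apply: alt; rewrite ?uniq3 ?ab ?ac // !inE !negb_or va vb.
have [e|xz] := eqVneq x z; first by subst z; apply: adjacent.
have -> : tperm x y * tperm z t = tperm x y * tperm x z * (tperm z x * tperm z t).
  by rewrite [tperm z x]tpermC -!mulgA (mulgA (tperm x z)) tperm2 mul1g.
by apply: hole_walkM; apply: adjacent => //; rewrite eq_sym.
Qed.

Lemma sym_walk s : (exists2 o, hole_walk G v v o & odd_perm o) -> s v = v ->
  hole_walk G v v s.
Proof.
move=> [o Wo oo].
have [a ao] : exists a, o a != a.
  apply/existsP; apply: contraTT oo => /existsPn H.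
  suff -> : o = 1 by rewrite odd_perm1.
  by apply/permP => t; rewrite perm1; apply/eqP; rewrite -[_ == _]negbK.
have ov := hole_walk_end Wo.
have av : v != a by apply: contraNneq ao => <-; rewrite ov.
have aov : v != o a by rewrite -{1}ov (inj_eq perm_inj).
pose tau := tperm a (o a).
(* [tau] serves only to correct the parity, and no walk realising it is known yet; induction on the
   number of moved points splits off [tperm x (t x)]. *)
have H n (t : {perm T}) : #|[set x | t x != x]| <= n -> t v = v ->
    hole_walk G v v (t * (if odd_perm t then tau else 1)).
  elim: n t => [|n IHn] t.
    rewrite leqn0 cards_eq0 => /eqP t0 _.
    have -> : t = 1.
      apply/permP => x; rewrite perm1; apply/eqP; rewrite -[_ == _]negbK.
      by have /setP/(_ x) := t0; rewrite !inE => ->.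
    by rewrite odd_perm1 mulg1 hole_walk1.
  move=> tn tv; have [/existsP[x tx]|/existsPn t1] := boolP [exists x, t x != x]; last first.
    by apply: IHn => //; rewrite (_ : [set _ | _] = set0) ?cards0 //;
      apply/setP => x; rewrite !inE (negbTE (t1 x)).
  pose t' := t * tperm x (t x).
  have xv : v != x by apply: contraNneq tx => <-; rewrite tv.
  have txv : v != t x by rewrite -{1}tv (inj_eq perm_inj).
  have t'E : t = t' * tperm x (t x) by rewrite /t' -mulgA tperm2 mulg1.
  have t'v : t' v = v by rewrite permM tv tpermD // eq_sym.
  have odd_t : odd_perm t = ~~ odd_perm t'.
    by rewrite {1}t'E odd_permM odd_tperm eq_sym tx addbT.
  have Wt' : hole_walk G v v (t' * (if odd_perm t' then tau else 1)).
    apply: IHn => //; rewrite -ltnS; apply: leq_trans tn; apply: proper_card.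
    apply/properP; split; last first.
      by exists x; rewrite !inE // permM tpermR eqxx.
    apply/subsetP => y; rewrite !inE; apply: contra => /eqP ty.
    rewrite permM ty tpermD //; first by apply: contraNneq tx => ->; rewrite ty.
    by apply: contraNneq tx => e; apply/eqP; apply: (@perm_inj _ t); rewrite e ty.
  have xtx : x != t x by rewrite eq_sym.
  have aoa : a != o a by rewrite eq_sym.
  rewrite odd_t {1}t'E; case: (odd_perm t') Wt' => /=; rewrite ?mulg1 => Wt'.
    have -> : t' * tperm x (t x) = t' * tau * (tau * tperm x (t x)).
      by rewrite -!mulgA (mulgA tau tau) (tperm2 a) mul1g.
    apply: hole_walkM Wt' _; apply: walk_tperm2 => //.
    by rewrite !inE !negb_or av aov xv txv.
  rewrite -mulgA; apply: hole_walkM Wt' _; apply: walk_tperm2 => //.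
  by rewrite !inE !negb_or av aov xv txv.
(* Applied to [o] itself, the claim realises [tau]. *)
have Wtau : hole_walk G v v tau.
  have := H _ o (leqnn _) ov; rewrite oo => Wot.
  by have := hole_walkM (hole_walkV Wo) Wot; rewrite mulKg.
move=> sv; have := H _ s (leqnn _) sv; case: odd_perm; last by rewrite mulg1.
by move=> W; have := hole_walkM W Wtau; rewrite -mulgA (tperm2 a) mulg1.
Qed.
End Symmetric.

Hypothesis G_nocut : forall v, joined_in G [set~ v].

Theorem wilson v s : ~ bipartite G ->
  ~ (exists2 k, 4 <= k & graph_iso G (cycle_graph k)) -> ~ graph_iso G theta0 ->
  s v = v -> hole_walk G v v s.
Proof.
move=> nb nc n0; apply: sym_walk (odd_closed_walk v nb) => x y z U vn.
(* Three distinct places besides the hole give the fourth vertex needed to find a theta. *)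
have T4 : 3 < #|T|.
  rewrite -[4]/(size [:: v; x; y; z]) -(card_uniqP (_ : uniq [:: v; x; y; z])).
    by apply: subset_leq_card; apply/subsetP.
  by rewrite cons_uniq vn.
have [S gS S3] := good_theta_good (good_theta_exists G_joined G_nocut T4 nc n0).
have [_ R] := good_setT G_joined G_nocut gS S3.
move: vn; rewrite !inE !negb_or ![v == _]eq_sym => /and3P[xv yv zv].
by apply: related_cycle3 => //; apply: R; rewrite ?inE ?xv ?yv ?zv.
Qed.
End Wilson.

(** * Blowing up multiplicities *)

Section Triangle.
Variables (T : finType) (G : sgraph T) (a b c : T).
Hypotheses (ab : adj G a b) (bc : adj G b c) (ac : adj G a c).

Lemma triangle_not_bipartite : ~ bipartite G.
Proof. by case=> f H; move: (H _ _ ab) (H _ _ bc) (H _ _ ac); do 3 case: (f _). Qed.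

Lemma triangle_not_cycle : ~ (exists2 k, 4 <= k & graph_iso G (cycle_graph k)).
Proof.
case=> k k4 [f _ H]; move: ab bc ac; rewrite -!H /= /sym_rel.
have S (i : 'I_k) : i.+1 %% k = i.+1 /\ i.+1 < k \/ i.+1 %% k = 0 /\ i.+1 = k.
  have := ltn_ord i; rewrite leq_eqVlt => /orP[/eqP e|lt].
    by right; rewrite e modnn.
  by left; rewrite modn_small.
move: (S (f a)) (S (f b)) (S (f c)); rewrite -!val_eqE /=.
move: (nat_of_ord (f a)) (nat_of_ord (f b)) (nat_of_ord (f c)) => x y z.
move: (x.+1 %% k) (y.+1 %% k) (z.+1 %% k) => x' y' z'.
by move: k4; clear; lia.
Qed.

Lemma triangle_not_theta0 : ~ graph_iso G theta0.
Proof.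
case=> f _ H; move: ab bc ac; rewrite -!H => xy yz xz.
have edge (i j : 'I_7) : adj theta0 i j -> theta0_edge i j by case/andP.
have /allP K : all (fun i => all (fun j => all (fun l =>
    ~~ [&& theta0_edge i j, theta0_edge j l & theta0_edge i l])
    (iota 0 7)) (iota 0 7)) (iota 0 7) by vm_compute.
have in7 (i : 'I_7) : val i \in iota 0 7 by rewrite mem_iota /=.
move: (K _ (in7 (f a))) => /allP/(_ _ (in7 (f b))) /allP/(_ _ (in7 (f c))).
by rewrite !edge.
Qed.
End Triangle.

Lemma del_vertex_connect (T : finType) (G : sgraph T) v x y :
  all_joined (del_vertex G v) -> x != v -> y != v ->
  connect (fun a b => adj G a b && (b != v)) x y.
Proof.
move=> J xv yv; have := J (Sub x xv) (Sub y yv); case/connectP=> p pth lst.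
apply/connectP; exists (map val p); last first.
  by have := congr1 val lst; rewrite -last_map !SubK.
rewrite -[x](SubK {x | x != v} xv); move: pth; apply: homo_path => a b /= ->.
exact: (valP b).
Qed.

(** * States and the permutations between them *)

Section States.
Variables (n : nat) (W : finType) (X : mgraph W).

Lemma state_card (s : fs_vertex 'I_n X) y : #|[set i | val s i == y]| = mult X y.
Proof. by apply/eqP; have /forallP := valP s. Qed.

Lemma count_codom (f : 'I_n -> W) y :
  count_mem y [tuple f i | i < n] = #|[set i | f i == y]|.
Proof.
rewrite -sum1_count big_map -sum1_card /= big_enum_cond /=.
by apply: eq_bigl => i; rewrite inE.
Qed.

Lemma state_exists : n = total_mult X -> exists s : fs_vertex 'I_n X, true.
Proof.
move=> hn; pose r := flatten [seq nseq (mult X y) y | y <- enum W].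
have sr : size r == n.
  rewrite size_flatten /shape -map_comp hn /total_mult sumnE big_map big_enum /=.
  by apply/eqP/eq_bigr => y _; rewrite size_nseq.
pose t := Tuple sr.
have valid : [forall y, #|[set i | [ffun i => tnth t i] i == y]| == mult X y].
  apply/forallP => y.
  rewrite -(count_codom [ffun i => tnth t i] y).
  have -> : [tuple [ffun i => tnth t i] i | i < n] = t.
    by apply: eq_from_tnth => i; rewrite tnth_mktuple ffunE.
  rewrite /t /= /r count_flatten -map_comp sumnE big_map big_enum /=.
  rewrite (bigD1 y) //= count_nseq /= eqxx mul1n big1 ?addn0 // => z zy.
  by rewrite count_nseq /= (negbTE zy).
by exists (exist _ [ffun i => tnth t i] valid : fs_vertex 'I_n X).
Qed.

Fact perm_state_subproof (s : fs_vertex 'I_n X) (p : {perm 'I_n}) :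
  [forall y, #|[set i | [ffun i => val s (p i)] i == y]| == mult X y].
Proof.
apply/forallP => y; rewrite (_ : [set i | _] = p @^-1: [set i | val s i == y]).
  by rewrite card_preimset ?state_card //; apply: perm_inj.
by apply/setP => i; rewrite !inE ffunE.
Qed.

Definition perm_state (s : fs_vertex 'I_n X) (p : {perm 'I_n}) : fs_vertex 'I_n X :=
  exist _ [ffun i => val s (p i)] (perm_state_subproof s p).

Lemma perm_stateP (s t : fs_vertex 'I_n X) : exists p, t = perm_state s p.
Proof.
have pe : perm_eq [tuple val t i | i < n] [tuple val s i | i < n].
  by apply/allP => y _ /=; rewrite !count_codom !state_card.
case/tuple_permP: pe => p e; exists p; apply: val_inj; apply/ffunP => i.
move/val_inj/(congr1 (fun u => tnth u i)): e.
by rewrite !tnth_mktuple ffunE.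
Qed.
End States.

Section BlowUp.
Variables (n : nat) (W : finType) (X : mgraph W) (s : fs_vertex 'I_n X).

(** The fixed state [s] labels the places: its fibre over [v] becomes a clique of [mult X v]
    places. *)
Definition blow_rel : rel 'I_n := fun i j =>
  (i != j) && ((val s i == val s j) || adj X (val s i) (val s j)).

Fact blow_sym : symmetric blow_rel.
Proof.
move=> i j; rewrite /blow_rel eq_sym; congr (_ && _).
by rewrite eq_sym adj_sym.
Qed.

Fact blow_irrefl : irreflexive blow_rel.
Proof. by move=> i; rewrite /blow_rel eqxx. Qed.

Definition blow : sgraph 'I_n := SGraph blow_sym blow_irrefl.

Lemma blow_adj i j : adj X (val s i) (val s j) -> adj blow i j.
Proof.
move=> ij; rewrite /= /blow_rel ij orbT andbT.
by apply: contraTneq ij => ->; rewrite adj_irrefl.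
Qed.

Lemma state_onto y : exists i, val s i = y.
Proof.
have := mult_gt0 X y; rewrite -(state_card s) card_gt0 => /set0Pn[i].
by rewrite inE => /eqP; exists i.
Qed.

Lemma clone i : 1 < mult X (val s i) -> exists2 j, j != i & val s j = val s i.
Proof.
rewrite -(state_card s) => /card_gt1P[a [b [+ + ab]]]; rewrite !inE => /eqP ai /eqP bi.
by have [ai'|] := eqVneq a i; [exists b; rewrite // -ai' eq_sym|exists a].
Qed.

Lemma state_inj1 i j : mult X (val s i) = 1 -> val s j = val s i -> j = i.
Proof.
rewrite -(state_card s) => /eqP/cards1P[k e] sj.
have : j \in [set i' | val s i' == val s i] by rewrite inE sj.
have : i \in [set i' | val s i' == val s i] by rewrite inE.
by rewrite e !inE => /eqP-> /eqP.
Qed.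

Section Lift.
Variable A : {set 'I_n}.

Let e : rel W := fun y y' => adj X y y' && [exists b in A, val s b == y'].

(** Each step of a path in [X] lifts to a place of [A] over its target; at the end, places over the
    same vertex are joined by their clique. *)
Lemma blow_lift a b : a \in A -> b \in A -> connect e (val s a) (val s b) ->
  connect (induced blow A) a b.
Proof.
move=> aA bA /connectP[p]; elim: p a aA => [|y p IHp] a aA /=.
  move=> _ sab; have [->|ab] := eqVneq a b; first exact: connect0.
  by apply: connect1; rewrite /induced /= /blow_rel ab sab eqxx aA.
case/andP=> /andP[ay /existsP[c /andP[cA /eqP cy]]]; rewrite -cy in ay *.
move=> pth lst; apply: connect_trans (IHp _ cA pth lst).
by apply: connect1; rewrite /induced blow_adj // aA.
Qed.
End Lift.

Hypothesis X_joined : all_joined X.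

Lemma blow_joined i j : connect blow i j.
Proof.
have : connect (induced blow setT) i j.
  apply: blow_lift; rewrite ?inE //; apply: connect_sub (X_joined _ _) => y y' yy'.
  apply: connect1; rewrite yy' /=; have [k <-] := state_onto y'.
  by apply/existsP; exists k; rewrite inE eqxx.
by apply: connect_sub => a b /and3P[ab _ _]; apply: connect1.
Qed.

(** With multiplicity at least two, another place over the same vertex replaces [v]; otherwise
    deleting [v] deletes the whole vertex, which leaves [X] joined. *)
Lemma blow_nocut v : 1 < mult X (val s v) \/ all_joined (del_vertex X (val s v)) ->
  joined_in blow [set~ v].
Proof.
move=> H a b aA bA; apply: blow_lift => //.
have [m2|] := ltnP 1 (mult X (val s v)).
  apply: connect_sub (X_joined _ _) => y y' yy'.
  apply: connect1; rewrite yy' /=; have [k <-] := state_onto y'.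
  apply/existsP; have [->|kv] := eqVneq k v; last by exists k; rewrite !inE kv eqxx.
  by have [j jv sj] := clone m2; exists j; rewrite !inE jv sj eqxx.
move=> m1; case: H => [|J]; first by rewrite ltnNge m1.
have {}m1 : mult X (val s v) = 1 by apply/eqP; rewrite eqn_leq m1 mult_gt0.
have neq c : c \in [set~ v] -> val s c != val s v.
  by rewrite !inE; apply: contraNneq => /(state_inj1 m1) ->.
apply: connect_sub (del_vertex_connect J (neq a aA) (neq b bA)) => y y' /andP[yy' y'v].
apply: connect1; rewrite yy' /=; have [k ek] := state_onto y'.
apply/existsP; exists k; rewrite !inE ek eqxx andbT.
by apply: contraNneq y'v => <-; rewrite ek.
Qed.

Lemma blow_triangle v y : 1 < mult X v -> adj X v y ->
  exists a b c, [/\ adj blow a b, adj blow b c & adj blow a c].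
Proof.
move=> m2 vy; have [i ei] := state_onto v; have [k ek] := state_onto y; subst v y.
have [j ji sj] := clone m2; exists i, j, k; split; try by apply: blow_adj; rewrite ?sj.
by rewrite /= /blow_rel eq_sym ji sj eqxx.
Qed.

Lemma blow_iso : (forall v, mult X v = 1) -> graph_iso blow X.
Proof.
move=> m1; have inj : injective (val s).
  by move=> i j e; apply: state_inj1 e; apply: m1.
exists (val s).
  apply: inj_card_bij => //.
  have onto y : y \in codom (val s) by have [i <-] := state_onto y; apply: codom_f.
  rewrite -(card_codom inj); apply: subset_leq_card; exact/subsetP.
move=> i j /=; rewrite /blow_rel (inj_eq inj).
by have [->|] := eqVneq i j; rewrite ?adj_irrefl.
Qed.
End BlowUp.

Section BlowConnected.
Variables (n : nat) (W : finType) (X : mgraph W) (s : fs_vertex 'I_n.+1 X).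

(** In [perm_state s p] token [i] is at place [p i], and token [ord0] is the hole. A step inside a
    clique leaves the state unchanged; any other is a move of [FS]. *)
Lemma blow_move (p : {perm 'I_n.+1}) b : adj (blow s) (p ord0) b ->
  connect (FS (star n.+1) X) (perm_state s p) (perm_state s (p * tperm (p ord0) b)%g).
Proof.
move=> /andP[ab /orP[/eqP e|Xab]].
  suff <- : perm_state s p = perm_state s (p * tperm (p ord0) b)%g by apply: connect0.
  by apply: val_inj; apply/ffunP => i; rewrite !ffunE permM; case: tpermP => // ->.
have pb : p (p^-1%g b) = b by rewrite permKV.
apply: connect1; apply/existsP; exists ord0; apply/existsP; exists (p^-1%g b).
apply/and3P; split.
- by rewrite /= /sym_rel eqxx andbT; apply: contraNneq ab => ->; rewrite pb.
- by rewrite !ffunE pb.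
apply/eqP/ffunP => i; rewrite !ffunE permM (inj_tperm _ _ _ (@perm_inj _ p)) pb.
by rewrite tpermK.
Qed.

Lemma blow_walk (p : {perm 'I_n.+1}) v g : hole_walk (blow s) (p ord0) v g ->
  connect (FS (star n.+1) X) (perm_state s p) (perm_state s (p * g)%g).
Proof.
have H q u t : path (move_rel (blow s)) (u, t) q -> u = (p * t)%g ord0 ->
    connect (FS (star n.+1) X) (perm_state s (p * t)%g) (perm_state s (p * (last (u, t) q).2)%g).
  elim: q u t => [|[u' t'] q IHq] u t /=; first by move=> _ _; apply: connect0.
  case/andP=> /andP[/= uu' /eqP ->] pth eu; apply: connect_trans (IHq _ _ pth _).
    by rewrite mulgA {1}eu; apply: blow_move; rewrite -eu.
  by rewrite mulgA permM -eu tpermL.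
case/connectP=> q pth e; have := H _ _ _ pth; rewrite mulg1 -e; exact.
Qed.

Lemma blow_connected :
  all_joined X ->
  (forall v, 1 < mult X v \/ all_joined (del_vertex X v)) ->
  ~ bipartite (blow s) ->
  ~ (exists2 k, 4 <= k & graph_iso (blow s) (cycle_graph k)) ->
  ~ graph_iso (blow s) theta0 ->
  connected (FS (star n.+1) X).
Proof.
move=> Xj Xc nb nc n0; split; first by apply/card_gt0P; exists s.
move=> t1 t2; have [p1 ->] := perm_stateP s t1; have [p2 ->] := perm_stateP s t2.
have [q Wq] := connect_hole_walk (blow_joined s Xj (p1 ord0) (p2 ord0)).
(* The factor before [q] fixes [p1 ord0], so Wilson's theorem realises it by a closed walk. *)
have -> : p2 = (p1 * (p1^-1 * p2 * q^-1 * q))%g by rewrite mulgKV mulKVg.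
apply: (@blow_walk _ (p2 ord0)); apply: (hole_walkM _ Wq).
apply: wilson => // [|v|]; first exact: blow_joined.
  exact: blow_nocut.
by rewrite !permM permK; have <- := hole_walk_end Wq; rewrite permK.
Qed.
End BlowConnected.

(** * Invariants *)

(* The number of places between the hole [h] and [p], going upwards around the
   cycle of length [k]. *)
Definition hole_dist (k h p : nat) : nat := if h < p then p - h.+1 else p + k - h.+1.

(** Read upwards from the hole, the tokens have distances 0 to [k - 2]; the second disjunct closes
    this sequence to a cyclic one. *)
Definition follows (k h p q : nat) : bool :=
  (hole_dist k h q == (hole_dist k h p).+1) ||
  ((hole_dist k h p == k - 2) && (hole_dist k h q == 0)).

Lemma hole_dist_lt k h p : h < k -> p < k -> p != h -> hole_dist k h p < k.-1.
Proof. by move=> hk pk ph; rewrite /hole_dist; case: (ltnP h p) => ?; lia. Qed.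

(** An upward move brings every token one nearer to the hole, except the one jumped over, which goes
    from distance 0 to [k - 2]. *)
Lemma hole_dist_up k h p : h < k -> p < k -> p != h -> forall h', h' = h.+1 %% k ->
  hole_dist k h' (if p == h' then h else p) =
  if hole_dist k h p is d.+1 then d else k - 2.
Proof.
move=> hk pk ph h'; move: (hk); rewrite leq_eqVlt => /orP[/eqP e|lt].
  rewrite -{1}e modnn => ->; rewrite /hole_dist; case: eqP => [p0|p0].
    by rewrite p0 ltn0 add0n -{2}e subnn; case: (ltnP 0 h) => ?; lia.
  have -> : 0 < p by lia.
  have -> : h < p = false by lia.
  have -> : p + k - h.+1 = p.-1.+1 by lia.
  by lia.
rewrite modn_small // => ->; rewrite /hole_dist; case: eqP => [p1|p1].
  have -> : h.+1 < h = false by lia.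
  have -> : h < p by lia.
  have -> : p - h.+1 = 0 by lia.
  by lia.
case: (ltnP h p) => hp.
  have -> : h.+1 < p by lia.
  by have -> : p - h.+1 = (p - h.+2).+1 by lia.
have -> : h.+1 < p = false by lia.
by have -> : p + k - h.+1 = (p + k - h.+2).+1 by lia.
Qed.

Lemma follows_up k h h' p q : h < k -> p < k -> q < k -> p != h -> q != h ->
  h' = h.+1 %% k ->
  follows k h p q =
  follows k h' (if p == h' then h else p) (if q == h' then h else q).
Proof.
move=> hk pk qk ph qh e; rewrite /follows !hole_dist_up //.
have := hole_dist_lt hk pk ph; have := hole_dist_lt hk qk qh.
case: (hole_dist k h p) => [|d]; case: (hole_dist k h q) => [|d'] /=; lia.
Qed.

(** A downward move is the reverse of an upward one, so both directions reduce to [follows_up]. *)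
Lemma follows_move k h h' p q : h < k -> h' < k -> p < k -> q < k ->
  p != h -> q != h -> h' != h -> (h' == h.+1 %% k) || (h == h'.+1 %% k) ->
  follows k h p q =
  follows k h' (if p == h' then h else p) (if q == h' then h else q).
Proof.
move=> hk hk' pk qk ph qh hh' /orP[/eqP e|/eqP e]; first exact: follows_up.
have back x : x != h -> (if (if x == h' then h else x) == h then h'
                         else (if x == h' then h else x)) = x.
  by move=> /negbTE xh; have [->|] := eqVneq x h'; rewrite ?eqxx ?xh.
rewrite [RHS](@follows_up _ _ h) // ?back //.
- by case: ifP.
- by case: ifP.
- by case: ifP => [_|/negbT //]; rewrite eq_sym.
- by case: ifP => [_|/negbT //]; rewrite eq_sym.
Qed.

Lemma follows_swap k h p q : 4 <= k -> h < k ->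
  (p = h + 1 /\ h + 1 < k \/ p = h + 1 - k /\ k <= h + 1) ->
  (q = h + 2 /\ h + 2 < k \/ q = h + 2 - k /\ k <= h + 2) ->
  follows k h p q != follows k h q p.
Proof.
move=> k4 hk ep eq; rewrite /follows /hole_dist.
by case: (ltnP h p) => ?; case: (ltnP h q) => ?; lia.
Qed.

(* A partition of the pairs from six places into five perfect matchings that
   both cycles of [theta0] through [0] preserve; [theta0_label] moves the six
   places other than the hole [h] back to [1, ..., 6] along a fixed path. *)
Definition theta0_total : seq (seq (nat * nat)) :=
  [:: [:: (1, 2); (3, 5); (4, 6)]; [:: (1, 3); (2, 6); (4, 5)];
      [:: (1, 4); (2, 3); (5, 6)]; [:: (1, 5); (2, 4); (3, 6)];
      [:: (1, 6); (2, 5); (3, 4)]].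

Definition theta0_label (h x : nat) : nat :=
  if h == 6 then (if x == 0 then 6 else x) else if x < h then x.+1 else x.

Definition theta0_colour (h x y : nat) : nat :=
  let a := theta0_label h x in let b := theta0_label h y in
  find (fun m => ((a, b) \in m) || ((b, a) \in m)) theta0_total.

Definition theta0_same (h x y z t : nat) : bool :=
  theta0_colour h x y == theta0_colour h z t.

Definition all7 (P : pred nat) : bool := all P (iota 0 7).

Lemma all7P P x : all7 P -> x < 7 -> P x.
Proof. by move/allP => H x7; apply: H; rewrite mem_iota. Qed.

Lemma theta0_same_move h w x y z t :
  h < 7 -> w < 7 -> x < 7 -> y < 7 -> z < 7 -> t < 7 -> theta0_edge h w ->
  h \notin [:: x; y; z; t] -> x != y -> z != t ->
  let r v := if v == w then h else v in
  theta0_same h x y z t = theta0_same w (r x) (r y) (r z) (r t).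
Proof.
move=> h7 w7 x7 y7 z7 t7 hw hn xy zt /=.
pose r (h w v : nat) := if v == w then h else v.
pose pairs (h : nat) := [seq q <- allpairs pair (iota 0 7) (iota 0 7) |
  [&& h != q.1, h != q.2 & q.1 != q.2]].
pose cols (h w : nat) (q : nat * nat) :=
  (theta0_colour h q.1 q.2, theta0_colour w (r h w q.1) (r h w q.2)).
(* For each edge, the pairs of colours before and after the move must form the graph of an injective
   function. [undup] keeps this quadratic check small. *)
have K : all7 (fun h => all7 (fun w => theta0_edge h w ==>
    let cs := undup [seq cols h w q | q <- pairs h] in
    all (fun a => all (fun b => (a.1 == b.1) == (a.2 == b.2)) cs) cs)).
  by vm_compute.
have := all7P (all7P K h7) w7; rewrite hw => /allP {}K.
move: hn; rewrite !inE !negb_or => /and4P[hx hy hz ht].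
have mem a b : a < 7 -> b < 7 -> h != a -> h != b -> a != b ->
    cols h w (a, b) \in undup [seq cols h w q | q <- pairs h].
  move=> a7 b7 ha hb ab; rewrite mem_undup map_f // mem_filter.
  apply/andP; split; first by rewrite /= ha hb.
  by apply/allpairsP; exists (a, b); rewrite !mem_iota.
have /allP := K _ (mem x y x7 y7 hx hy xy).
by move/(_ _ (mem z t z7 t7 hz ht zt)) => /eqP.
Qed.

(** For each hole, four tokens on which exchanging the middle two alters the invariant. *)
Lemma theta0_witness h : h < 7 -> exists x y z t,
  [/\ all (gtn 7) [:: x; y; z; t], uniq [:: h; x; y; z; t],
      theta0_same h x y z t & ~~ theta0_same h x z y t].
Proof.
move=> h7; pose good h (q : nat * nat * nat * nat) := let: (x, y, z, t) := q in
  [&& all (gtn 7) [:: x; y; z; t], uniq [:: h; x; y; z; t],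
      theta0_same h x y z t & ~~ theta0_same h x z y t].
have K : all7 (fun h => has (good h)
    [:: (1, 2, 3, 5); (0, 2, 3, 5); (0, 1, 3, 5); (0, 1, 2, 5); (0, 1, 2, 4)]) by vm_compute.
have /hasP[[[[x y] z] t] _ /and4P[? ? ? ?]] := all7P K h7.
by exists x, y, z, t.
Qed.

Section Invariants.
Variables (n : nat) (W : finType) (X : mgraph W).
Notation state := (fs_vertex 'I_n.+1 X).
Implicit Types (s t : state).

Lemma star_moveP s t : adj (FS (star n.+1) X) s t -> exists b,
  [/\ b != ord0, adj X (val s ord0) (val s b) &
      forall i, val t i = val s (tperm ord0 b i)].
Proof.
case/existsP=> a /existsP[b /and3P[/andP[ab a0b0] sab /eqP st]].
have ts i : val t i = val s (tperm a b i) by rewrite st ffunE tpermK.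
case/orP: a0b0 => /eqP z.
  have a0 : a = ord0 by apply: val_inj.
  by subst a; exists b; rewrite eq_sym.
have b0 : b = ord0 by apply: val_inj.
by subst b; exists a; split=> // [|i]; rewrite ?ts 1?tpermC // adj_sym.
Qed.

Lemma invariant_const (Q : pred state) :
  (forall s t, adj (FS (star n.+1) X) s t -> Q s = Q t) ->
  connected (FS (star n.+1) X) -> forall s t, Q s = Q t.
Proof. by move=> H [_ J] s t; apply: (closed_connect (a := Q)) (J s t) => a b /H. Qed.

(* For [v] of multiplicity one, the tokens behind [v] never change: a token
   at [v] counts as being on the side of the hole. *)
Lemma cut_vertex_mult v : connected (FS (star n.+1) X) -> cut_vertex X v ->
  1 < mult X v.
Proof.
move=> cF cv; rewrite ltnNge; apply/negP => m1; apply: cv => x y.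
apply/negPn/negP => nxy.
have {}m1 : mult X v = 1 by apply/eqP; rewrite eqn_leq m1 mult_gt0.
(* The component of [x] after deleting [v], extended by [false] at [v]. *)
pose A z := if insub z is Some z' then connect (del_vertex X v) x z' else false.
have AE (z : {x | x != v}) : A (val z) = connect (del_vertex X v) x z by rewrite /A valK.
have Av : A v = false by rewrite /A insubN // eqxx.
have A_adj a b : a != v -> b != v -> adj X a b -> A a = A b.
  move=> av bv ab; rewrite -[a](SubK {x | x != v} av) -[b](SubK {x | x != v} bv) !AE.
  apply: (same_connect_r (sym_connect_sym (@del_vertex_sym _ X v))).
  exact: connect1.
have [s0 _] := card_gt0P cF.1.
have [pv epv] := state_onto s0 v.
(* With the hole at [v], the tokens found over [x] and [y] differ from the hole. *)
pose s := perm_state s0 (tperm ord0 pv).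
have sv : val s ord0 = v by rewrite ffunE tpermL.
clearbody s.
have [i ei] := state_onto s (val x); have [j ej] := state_onto s (val y).
have i0 : i != ord0 by apply: contraNneq (valP x) => e; rewrite -ei e sv.
have j0 : j != ord0 by apply: contraNneq (valP y) => e; rewrite -ej e sv.
pose Q (t : state) := A (val t i) || ((val t i == v) && A (val t ord0)).
have inv : forall s t, adj (FS (star n.+1) X) s t -> Q s = Q t.
  move=> {s sv ei ej} s t /star_moveP[b [b0 hw ts]]; rewrite /Q !ts tpermL.
  have one a c : val s a = v -> val s c = v -> a = c.
    by move=> sa sc; apply: (state_inj1 (s := s)); rewrite ?sc ?sa.
  have [bi|bi] := eqVneq b i.
    subst b; rewrite tpermR.
    have [iv|iv] := eqVneq (val s i) v.
      have hv : val s ord0 != v by apply: contraNneq i0 => hv; rewrite (one i ord0).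
      by rewrite iv Av (negbTE hv) orbF.
    have [hv|hv] := eqVneq (val s ord0) v; first by rewrite hv Av orbF.
    by rewrite !orbF; apply/esym/A_adj.
  rewrite tpermD // 1?eq_sym //; have [iv|//] := eqVneq (val s i) v.
  rewrite !iv Av /=; apply: A_adj hw.
    by apply: contraNneq i0 => hv; rewrite (one i ord0).
  by apply: contraNneq bi => bv; rewrite (one i b).
have := invariant_const inv cF s (perm_state s (tperm i j)).
have -> : Q s by rewrite /Q ei AE connect0.
by rewrite /Q !ffunE tpermL ej AE (negbTE nxy) (negbTE (valP y)).
Qed.

Section Injective.
Hypothesis m1 : forall v, mult X v = 1.

Let s_inj s : injective (val s).
Proof. by move=> i j e; apply: state_inj1 e; apply: m1. Qed.

(** Each move is a transposition and flips the colour under the hole, so parity is fixed by the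
    start and end of the hole. Exchanging two other tokens, which [1 < n] provides, is odd and keeps
    the hole in place. *)
Lemma bipartite_not_connected : 1 < n -> connected (FS (star n.+1) X) -> ~ bipartite X.
Proof.
move=> n2 cF [f Hf].
have par s t : connect (FS (star n.+1) X) s t -> exists2 p : {perm 'I_n.+1},
    (forall i, val t i = val s (p i)) &
    odd_perm p = f (val s ord0) (+) f (val t ord0).
  case/connectP=> q; elim: q s => [|r q IHq] s /=.
    by move=> _ ->; exists 1%g => [i|]; rewrite ?perm1 // odd_perm1 addbb.
  case/andP=> /star_moveP[b [b0 sb rs]] pth e.
  have [p tp op] := IHq _ pth e; exists (p * tperm ord0 b)%g.
    by move=> i; rewrite tp rs permM.
  rewrite odd_permM op odd_tperm eq_sym b0 rs tpermL.
  by move: (Hf _ _ sb); case: (f _); case: (f _); case: (f _).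
have [s _] := card_gt0P cF.1.
pose i : 'I_n.+1 := inord 1; pose j : 'I_n.+1 := inord 2.
have iE : val i = 1 by rewrite /= inordK //; lia.
have jE : val j = 2 by rewrite /= inordK //; lia.
have ij : i != j by rewrite -val_eqE iE jE.
have [p pE] := par _ _ (cF.2 s (perm_state s (tperm i j))).
have -> : p = tperm i j.
  by apply/permP => k; have := pE k; rewrite ffunE => /s_inj.
rewrite odd_tperm ij ffunE tpermD ?addbb //; by rewrite -val_eqE ?iE ?jE.
Qed.

(** Whether [j] follows [i] in the cyclic order is invariant; exchanging the first two tokens above
    the hole changes it. *)
Lemma cycle_not_connected k : connected (FS (star n.+1) X) -> 4 <= k ->
  ~ graph_iso X (cycle_graph k).
Proof.
move=> cF k4 [f [g fK gK] Hf].
have f_inj := can_inj fK.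
have [s _] := card_gt0P cF.1.
pose pos (t : state) i : nat := f (val t i).
have pos_lt t i : pos t i < k by apply: ltn_ord.
have pos_eq t i j : (pos t i == pos t j) = (i == j).
  by rewrite /pos (inj_eq val_inj) (inj_eq f_inj) (inj_eq (@s_inj t)).
have pos_onto h : h < k -> exists i, pos s i = h.
  move=> hk; have [i ei] := state_onto s (g (Ordinal hk)).
  by exists i; rewrite /pos ei gK.
pose h := pos s ord0; have hk : h < k by apply: pos_lt.
have [i ei] := pos_onto ((h + 1) %% k) (ltn_pmod _ (ltnW (ltnW (ltnW k4)))).
have [j ej] := pos_onto ((h + 2) %% k) (ltn_pmod _ (ltnW (ltnW (ltnW k4)))).
have S d : d < k -> (h + d) %% k = h + d /\ h + d < k \/
    (h + d) %% k = h + d - k /\ k <= h + d.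
  move=> dk; case: (ltnP (h + d) k) => hd; first by left; rewrite modn_small.
  by right; rewrite -{1}(subnK hd) modnDr modn_small //; lia.
have S1 := S 1 (ltnW (ltnW k4)); have S2 := S 2 (ltnW k4).
rewrite -ei in S1; rewrite -ej in S2.
have i0 : i != ord0 by rewrite -(pos_eq s) -/h; lia.
have j0 : j != ord0 by rewrite -(pos_eq s) -/h; lia.
have ij : i != j by rewrite -(pos_eq s); lia.
pose Q (t : state) := follows k (pos t ord0) (pos t i) (pos t j).
have inv : forall s t, adj (FS (star n.+1) X) s t -> Q s = Q t.
  move=> s' t /star_moveP[b [b0 hw ts]].
  have post l : l != ord0 ->
      pos t l = if pos s' l == pos s' b then pos s' ord0 else pos s' l.
    move=> l0; rewrite pos_eq /pos ts; have [->|lb] := eqVneq l b; first by rewrite tpermR.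
    by rewrite tpermD // eq_sym.
  have post0 : pos t ord0 = pos s' b by rewrite /pos ts tpermL.
  rewrite /Q post0 (post i i0) (post j j0); apply: follows_move; rewrite ?pos_lt ?pos_eq //.
  by move: hw; rewrite -Hf => /andP[_].
have := invariant_const inv cF s (perm_state s (tperm i j)).
rewrite /Q /pos !ffunE tpermL tpermR [tperm _ _ ord0]tpermD // -/(pos s i) -/(pos s j).
by move/eqP; apply/negP; apply: follows_swap.
Qed.

Lemma theta0_not_connected : connected (FS (star n.+1) X) -> ~ graph_iso X theta0.
Proof.
move=> cF [f [g fK gK] Hf].
have f_inj := can_inj fK.
have [s _] := card_gt0P cF.1.
pose pos (t : state) i : nat := f (val t i).
have pos_lt t i : pos t i < 7 by apply: ltn_ord.
have pos_eq t i j : (pos t i == pos t j) = (i == j).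
  by rewrite /pos (inj_eq val_inj) (inj_eq f_inj) (inj_eq (@s_inj t)).
have pos_onto h : h < 7 -> exists i, pos s i = h.
  move=> hk; have [i ei] := state_onto s (g (Ordinal hk)).
  by exists i; rewrite /pos ei gK.
have [x [y [z [t [/and5P[/= x7 y7 z7 t7 _] U same nsame]]]]] :=
  theta0_witness (pos_lt s ord0).
have [a ea] := pos_onto x x7; have [b eb] := pos_onto y y7.
have [c ec] := pos_onto z z7; have [d ed] := pos_onto t t7.
subst x y z t.
move: U; rewrite /= !inE !negb_or !pos_eq ![ord0 == _]eq_sym.
case/and5P=> /and4P[a0 b0 c0 d0] /and3P[ab ac ad] /andP[bc bd] cd _.
pose Q (t : state) := theta0_same (pos t ord0) (pos t a) (pos t b) (pos t c) (pos t d).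
have inv : forall s t, adj (FS (star n.+1) X) s t -> Q s = Q t.
  move=> s' t /star_moveP[e [e0 hw ts]].
  have post l : l != ord0 ->
      pos t l = if pos s' l == pos s' e then pos s' ord0 else pos s' l.
    move=> l0; rewrite pos_eq /pos ts; have [->|lb] := eqVneq l e; first by rewrite tpermR.
    by rewrite tpermD // eq_sym.
  have post0 : pos t ord0 = pos s' e by rewrite /pos ts tpermL.
  rewrite /Q post0 (post a a0) (post b b0) (post c c0) (post d d0).
  apply: theta0_same_move; rewrite ?pos_lt ?pos_eq //.
    by move: hw; rewrite -Hf => /andP[_].
  by rewrite !inE !negb_or !pos_eq ![ord0 == _]eq_sym a0 b0 c0.
have := invariant_const inv cF s (perm_state s (tperm b c)).
have swap l : pos (perm_state s (tperm b c)) l = pos s (tperm b c l).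
  by rewrite /pos ffunE.
rewrite /Q same !swap tpermL tpermR !tpermD // 1?eq_sym // => e.
by rewrite -e in nsame.
Qed.
End Injective.
End Invariants.

Lemma not_cut_joined (T : finType) (G : sgraph T) v :
  ~ cut_vertex G v -> all_joined (del_vertex G v).
Proof. by move=> nc x y; apply/negPn/negP => nxy; apply: nc => J; rewrite J in nxy. Qed.

Lemma joined_neighbour (T : finType) (G : sgraph T) x y :
  all_joined G -> x != y -> exists z, adj G x z.
Proof.
move=> J xy; have [||a [b [ab]]] := @connect_exit _ G [set x] x y (J x y).
- by rewrite inE.
- by rewrite inE eq_sym.
by rewrite inE => /eqP e _; subst a; exists b.
Qed.

Lemma graph_iso_trans (T U V : finType) (G : sgraph T) (H : sgraph U) (K : sgraph V) :
  graph_iso G H -> graph_iso H K -> graph_iso G K.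
Proof.
move=> [f bf Hf] [g bg Hg]; exists (g \o f); first exact: bij_comp.
by move=> x y; rewrite /= Hg Hf.
Qed.

Lemma graph_iso_sym (T U : finType) (G : sgraph T) (H : sgraph U) :
  graph_iso G H -> graph_iso H G.
Proof.
move=> [f [g fK gK] Hf]; exists g; first by exists f.
by move=> x y; rewrite -Hf !gK.
Qed.

Lemma iso_bipartite (T U : finType) (G : sgraph T) (H : sgraph U) :
  graph_iso G H -> bipartite H -> bipartite G.
Proof.
move=> [f _ Hf] [c Hc]; exists (c \o f) => x y xy.
by apply: Hc; rewrite Hf.
Qed.

(** * Sufficient conditions for connectedness *)

Section Sufficient.
Variables (n : nat) (W : finType) (X : mgraph W).
Hypotheses (hn : n.+1 = total_mult X) (X_joined : all_joined X).
Hypothesis X_cut : forall v, 1 < mult X v \/ all_joined (del_vertex X v).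

Lemma connected_of_mult v : 1 < mult X v -> connected (FS (star n.+1) X).
Proof.
move=> m2; have [s _] := state_exists hn.
have [/existsP[y vy]|/existsPn all_v] := boolP [exists y, v != y].
  have [z vz] := joined_neighbour X_joined vy.
  have [a [b [c [ab bc ac]]]] := blow_triangle s m2 vz.
  apply: (blow_connected (s := s)) => //.
  - exact: triangle_not_bipartite ab bc ac.
  - exact: triangle_not_cycle ab bc ac.
  - exact: triangle_not_theta0 ab bc ac.
(* With a single vertex there is only one state. *)
split; first by apply/card_gt0P; exists s.
have eqv y : y = v by have := all_v y; rewrite negbK => /eqP.
move=> t t'; suff -> : t = t' by apply: connect0.
by apply: val_inj; apply/ffunP => i; rewrite (eqv (val t i)) (eqv (val t' i)).
Qed.

Lemma connected_of_simple : (forall v, mult X v = 1) -> ~ bipartite X ->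
  ~ (exists2 k, 4 <= k & graph_iso X (cycle_graph k)) -> ~ graph_iso X theta0 ->
  connected (FS (star n.+1) X).
Proof.
move=> m1 nb nc n0; have [s _] := state_exists hn.
have iso := graph_iso_sym (blow_iso s m1).
apply: (blow_connected (s := s)) => //.
- by move/(iso_bipartite iso).
- by case=> k k4 /(graph_iso_trans iso) ik; apply: nc; exists k.
- by move/(graph_iso_trans iso).
Qed.
End Sufficient.

Lemma mult_dichotomy (W : finType) (X : mgraph W) :
  (exists v, 1 < mult X v) \/ (forall v, mult X v = 1).
Proof.
have [/existsP|/existsPn H] := boolP [exists v, 1 < mult X v]; first by left.
by right=> v; apply/eqP; rewrite eqn_leq mult_gt0 andbT leqNgt.
Qed.

(** The extra hypothesis of the second clause excludes one vertex or one edge with all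
    multiplicities one: these are biconnected and bipartite, yet their [FS] is connected. *)
Theorem theorem1p4 (m n : nat) (X : mgraph 'I_m)
    (hn : n = total_mult X) (hX : connected X) :
  [/\ wilsonian X -> connected (FS (star n) X),
      biconnected X -> ~ wilsonian X ->
        ~ (m <= 2 /\ (forall v, mult X v = 1)) ->
        (connected (FS (star n) X) <-> exists v, 2 <= mult X v) &
      ~ biconnected X ->
        (connected (FS (star n) X) <->
         forall v, cut_vertex X v -> 2 <= mult X v)].
Proof.
case: n hn => [|n] hn.
  have [v _] := card_gt0P hX.1; move/esym/eqP: hn.
  by rewrite sum_nat_eq0 => /forallP/(_ v); have := mult_gt0 X v; case: mult.
have J := hX.2; split.
- case=> [[_ nocut] nb nc n0].
  have Xc v : 1 < mult X v \/ all_joined (del_vertex X v).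
    by right; apply/not_cut_joined/nocut.
  have [[v m2]|m1] := mult_dichotomy X; first exact: (connected_of_mult hn J Xc m2).
  exact: connected_of_simple.
- move=> bX nW nsmall; split; last first.
    by case=> v; apply: connected_of_mult => // u; right; apply/not_cut_joined/bX.2.
  move=> cF; have [//|m1] := mult_dichotomy X.
  (* Three vertices leave two tokens besides the hole, as the parity argument requires. *)
  have m3 : 2 < m by rewrite ltnNge; apply/negP => m2; apply: nsmall.
  have nm : n.+1 = m.
    by rewrite hn /total_mult (eq_bigr (fun=> 1)) // sum1_card card_ord.
  case: nW; split=> //.
  + by apply: bipartite_not_connected cF => //; lia.
  + by case=> k k4; apply: (cycle_not_connected m1 cF k4).
  + exact: theta0_not_connected m1 cF.
move=> nb; split=> [cF v cv|cm]; first exact: cut_vertex_mult cF cv.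
have Xc v : 1 < mult X v \/ all_joined (del_vertex X v).
  have [m2|m1] := ltnP 1 (mult X v); [by left|right].
  by apply: not_cut_joined => /cm; rewrite ltnNge m1.
have [[v m2]|m1] := mult_dichotomy X; first exact: (connected_of_mult hn J Xc m2).
(* With all multiplicities one, [cm] leaves no cut vertex, so [X] would be biconnected. *)
by case: nb; split=> // v /cm; rewrite m1.
Qed.
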